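(* Consider the $T$-periodic linear impulsive Hamiltonian system $$x'=a(t)x+b(t)u,\quad u'=-c(t)x-a(t)u,\quad t\neq\tau_i,$$ $$x(\tau_i+)=\alpha_i x(\tau_i-),\quad u(\tau_i+)=\alpha_i u(\tau_i-)-\beta_i x(\tau_i-),\qquad t\in\mathbb R,\ i\in\mathbb Z,$$ under the standing assumptions on $T$, $r$, $\tau_i$, $\alpha_i$, $\beta_i$, $a$, $b$, $c$ listed in the context. Assume that $$\prod_{i=1}^{r}\alpha_i^2=1;$$ $$b(t)>0,\qquad \int_0^T\left(c(t)-\frac{a^2(t)}{b(t)}\right)\,dt+\sum_{i=1}^r\frac{\beta_i}{\alpha_i}>0;$$ $$\exp\left(2\int_0^T|a(u)|\,du\right)\left[\int_0^T b(t)\,dt\right]\left[\int_0^T c^+(t)\,dt+\sum_{i=1}^r\left(\frac{\beta_i}{\alpha_i}\right)^+\right]<4.$$ Then the impulsive system is stable.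
   Context: Standing assumptions: $T>0$ is a real number and $r$ is a positive integer. $\{\tau_i\}_{i\in\mathbb Z}$ is a sequence of real numbers (impulse points) with $\tau_i<\tau_{i+1}$ and $\tau_{i+r}=\tau_i+T$ for all $i\in\mathbb Z$, and $0<\tau_1<\tau_2<\cdots<\tau_r<T$. The functions $a,b,c:\mathbb R\setminus\{\tau_i: i\in\mathbb Z\}\to\mathbb R$ satisfy $a(t+T)=a(t)$, $b(t+T)=b(t)$, $c(t+T)=c(t)$ for all $t\in\mathbb R\setminus\{\tau_i:i\in\mathbb Z\}$, and $a,b,c\in \mathrm{PC}[0,T]$. The real sequences $\{\alpha_i\},\{\beta_i\}$ ($i\in\mathbb Z$) satisfy $\alpha_i\neq0$, $\alpha_{i+r}=\alpha_i$, $\beta_{i+r}=\beta_i$ for all $i\in\mathbb Z$. Here $\mathrm{PC}[0,T]$ is the set of functions $f:[0,T]\setminus\{\tau_1,\dots,\tau_r\}\to\mathbb R$ that are continuous on $[0,T]\setminus\{\tau_1,\dots,\tau_r\}$ and for which the left-hand limit $f(\tau_i-)$ and the right-hand limit $f(\tau_i+)$ exist (finite) for each $i\in\{1,\dots,r\}$. Notation: $c^+(t)=\max\{c(t),0\}$ and $(\beta_i/\alpha_i)^+=\max\{\beta_i/\alpha_i,0\}$. A solution is a pair $(x,u)$ satisfying the differential equations for $t\ne\tau_i$, having one-sided limits at each $\tau_i$, and satisfying the jump conditions at every $\tau_i$. The system is called stable if all its solutions are bounded on $\mathbb R$. *)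

(* Defs.v *)
From HB Require Import structures.
From mathcomp Require Import all_boot all_order all_algebra.
From mathcomp Require Import all_classical all_reals all_analysis.

Set Implicit Arguments.
Unset Strict Implicit.
Unset Printing Implicit Defensive.

Import Order.TTheory GRing.Theory Num.Theory.
Import numFieldNormedType.Exports.

Local Open Scope classical_set_scope.
Local Open Scope ring_scope.

(* Functions on R \ {tau_i : i in Z} are represented by total functions R -> R
   whose values on [range tau] are arbitrary: every condition below only reads
   them off [range tau] (the filters s^'- and s^'+ exclude s). *)

Definition in_PC (R : realType) (T : R) (r : nat) (tau : int -> R)
    (f : R -> R) : Prop :=
  {within `[0, T] `\` [set tau i%:Z | i in [set i | (1 <= i <= r)%N]],
     continuous f} /\
  forall i : nat, (1 <= i <= r)%N ->
    cvg (f @ (tau i%:Z)^'-) /\ cvg (f @ (tau i%:Z)^'+).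

Definition periodic_off (R : realType) (T : R) (tau : int -> R)
    (f : R -> R) : Prop :=
  forall t, ~ range tau t -> f (t + T) = f t.

Definition hamiltonian_solution (R : realType) (tau alpha beta : int -> R)
    (a b c x u : R -> R) : Prop :=
  [/\ forall t, ~ range tau t ->
        is_derive t 1 x (a t * x t + b t * u t) /\
        is_derive t 1 u (- c t * x t - a t * u t),
      forall i, [/\ cvg (x @ (tau i)^'-), cvg (x @ (tau i)^'+),
                    cvg (u @ (tau i)^'-) & cvg (u @ (tau i)^'+)]
    & forall i,
        lim (x @ (tau i)^'+) = alpha i * lim (x @ (tau i)^'-) /\
        lim (u @ (tau i)^'+) =
          alpha i * lim (u @ (tau i)^'-) - beta i * lim (x @ (tau i)^'-)].

Definition stable (R : realType) (tau alpha beta : int -> R)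
    (a b c : R -> R) : Prop :=
  forall x u, hamiltonian_solution tau alpha beta a b c x u ->
    exists M : R, forall t, ~ range tau t -> `|x t| <= M /\ `|u t| <= M.

(* Main.v *)
Require Import Defs.
From HB Require Import structures.
From mathcomp Require Import all_boot all_order all_algebra.
From mathcomp Require Import all_classical all_reals all_analysis.
From mathcomp Require Import ring lra zify.

Set Implicit Arguments.
Unset Strict Implicit.
Unset Printing Implicit Defensive.

Import Order.TTheory GRing.Theory Num.Theory.
Import numFieldNormedType.Exports.

Local Open Scope classical_set_scope.
Local Open Scope ring_scope.

(** The theorem rests on a Floquet-type dichotomy and on two estimates that
exclude real multipliers.

Let [z = (x, u)] be a solution and [S z] its translate by [T]. The Wronskian of
two solutions is constant between impulses and is multiplied by [alpha i ^+ 2]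
at [tau i]; since these factors have product [1] over a period, the Wronskian
takes the same value at [0] and at [T] ([wronskian_period]). Solutions are
determined by their value at one point ([solution_unique]), so the solutions
[z], [S z], [S^2 z] satisfy [S^2 z = p S z - z] unless [S z] is a multiple of
[z]. If [`|p| < 2], the form [X(t+T)^2 - p X(t+T) X(t) + X(t)^2] is positive
definite and [T]-periodic for [X = x] and [X = u], whence [z] is bounded; no
existence theorem for the differential equation is needed. If [`|p| >= 2], the
polynomial [X^2 - p X + 1] has real roots [l] and [m], and [S z - m z] is a
nonzero solution that [S] multiplies by [l]. Hence a solution is bounded
unless some nonzero solution has a real multiplier ([bounded_or_floquet]). It
remains to see that there is no such solution.

Let [(x, u)] have a real multiplier. If [x] has no zero on [[0, T]], then [v = u / x] takes the same
value at [0] and [T], satisfies [v' = - (c - a^2/b) - b (v + a/b)^2], and drops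
by [beta i / alpha i] at [tau i]; integrating over a period contradicts the
positivity of the mean ([riccati_le0]).

If [x] vanishes at [t0], it also vanishes at [t0 + T]. Dividing by the product
of the [alpha i] over the impulses already met removes the jumps of [x], and
the factors [exp (-A)], [exp A] with [A' = a] remove the terms in [a]; this
leaves [y' = exp(-2A) b w] and [w' = - exp(2A) c y] with [y] continuous. The
argument of Lyapunov then applies: between two zeros around a maximum [M] of
[y], the function [w] must come up to [M / p] on the left and down to
[- M / q] on the right, where [p] and [q] are the integrals of [exp(-2A) b] on
the two sides, while the positive part of [c] and of
the impulses bounds the decrease of [w]; as [1/p + 1/q >= 4/(p + q)], the
product in the last hypothesis is at least [4] ([lyapunov],
[zero_lyapunov]).

All differential inequalities are integrated by means of one principle: a
function with nonnegative derivative off a finite set, and with no downward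
jump, is nondecreasing ([le_lim_jump]). *)

(** * Calculus with finitely many exceptional points *)

(** A relation between the ends of an interval holds for every interval as soon
as it holds for those that contain no point of the finite set [D] and can be
composed at the points of [D]. *)
Lemma interval_chain (R : realType) (Q : R -> R -> Prop) (D : seq R) :
  (forall p q, p < q -> (forall d, d \in D -> ~~ (p < d < q)) -> Q p q) ->
  (forall p d q, p < d -> d < q -> d \in D -> Q p d -> Q d q -> Q p q) ->
  forall p q, p < q -> Q p q.
Proof.
move=> base step.
suff H (E : seq R) p q : p < q ->
    (forall d, d \in D -> p < d < q -> d \in E) -> Q p q.
  by move=> p q pq; apply: (H D).
elim: E p q => [|e E IH] p q pq DE.
  by apply: base => // d dD; apply/negP => /(DE _ dD).
have [/andP[eD /andP[pe eq]]|He] := boolP [&& e \in D, p < e & e < q].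
  apply: (step p e q) => //; apply: IH => // d dD /andP[pd dq].
    have /= := DE d dD; rewrite pd (lt_trans dq eq) inE => /(_ isT).
    by rewrite (lt_eqF dq).
  have /= := DE d dD; rewrite dq (lt_trans pe pd) inE => /(_ isT).
  by rewrite (gt_eqF pd).
apply: IH => // d dD dpq; have := DE d dD dpq; rewrite inE => /orP[/eqP de|//].
by move: He; rewrite -de dD dpq.
Qed.

Lemma exists_off_seq (R : realType) (D : seq R) (p q : R) :
  p < q -> exists2 t, p < t < q & t \notin D.
Proof.
elim: D p q => [|d D IH] p q pq.
  by exists ((p + q) / 2); rewrite ?(midf_lt pq).
have [t1 /andP[pt1 t1q] t1D] := IH p q pq.
have [t1d|] := eqVneq t1 d; last first.
  by move=> t1d; exists t1; rewrite ?pt1// inE negb_or t1d.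
have [t2 /andP[pt2 t2q] t2D] := IH p t1 pt1.
exists t2; first by rewrite pt2 (lt_trans t2q).
by rewrite inE negb_or t2D -t1d lt_eqF.
Qed.

Lemma derive_ge0_homo (R : realType) (f df : R -> R) (p q : R) :
  (forall t, p < t < q -> is_derive t 1 f (df t)) ->
  (forall t, p < t < q -> 0 <= df t) ->
  forall s t, p < s -> s <= t -> t < q -> f s <= f t.
Proof.
move=> fd fge s t ps; rewrite le_eqVlt => /predU1P[->//|st] tq.
have sub z : s <= z <= t -> p < z < q.
  by move=> /andP[sz zt]; rewrite (lt_le_trans ps sz) (le_lt_trans zt tq).
have fd' z : z \in `]s, t[ -> is_derive z 1 f (df z).
  by rewrite in_itv/= => /andP[/ltW sz /ltW zt]; apply: fd; apply: sub; rewrite sz.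
have fc : {within `[s, t], continuous f}.
  apply: continuous_in_subspaceT => z; rewrite inE/= in_itv/= => zst.
  have [fz _] := fd z (sub _ zst).
  exact/differentiable_continuous/derivable1_diffP.
have [z zst E] := MVT st fd' fc.
rewrite -subr_ge0 E; apply: mulr_ge0; last by rewrite subr_ge0 ltW.
by apply: fge; apply: sub; move: zst; rewrite in_itv/= => /andP[/ltW-> /ltW->].
Qed.

Lemma derive_ge0_le_lim (R : realType) (f df : R -> R) (p q A B : R) : p < q ->
  (forall t, p < t < q -> is_derive t 1 f (df t)) ->
  (forall t, p < t < q -> 0 <= df t) ->
  f x @[x --> p^'+] --> A -> f x @[x --> q^'-] --> B -> A <= B.
Proof.
move=> pq fd fge fA fB.
have mono := derive_ge0_homo fd fge.
have [pm mq] := midf_lt pq; set m := (p + q) / 2 in pm mq.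
apply: (@le_trans _ _ (f m)).
  apply: (cvgr_to_le fA); near=> x; apply: mono => //.
  - by near: x; exact: nbhs_right_ltW.
apply: (cvgr_to_ge fB); near=> x; apply: mono => //.
by near: x; exact: nbhs_left_ge.
Unshelve. all: by end_near. Qed.

(** A function that is nondecreasing between the points of [D] and does not
jump down at these points is nondecreasing. *)
Lemma le_lim_jump (R : realType) (f df : R -> R) (D : seq R) (p q A B : R) :
  p < q ->
  (forall t, p < t < q -> t \notin D -> is_derive t 1 f (df t)) ->
  (forall t, p < t < q -> t \notin D -> 0 <= df t) ->
  (forall t, p < t < q -> t \in D -> exists l r,
     [/\ f x @[x --> t^'-] --> l, f x @[x --> t^'+] --> r & l <= r]) ->
  f x @[x --> p^'+] --> A -> f x @[x --> q^'-] --> B -> A <= B.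
Proof.
move=> pq fd fge fj fA fB.
pose Q s t := p <= s -> t <= q -> forall A B, f x @[x --> s^'+] --> A ->
  f x @[x --> t^'-] --> B -> A <= B.
suff : Q p q by apply.
apply: (@interval_chain R Q D) pq => {A B fA fB}
  [s t st sD ps tq A B fA fB|s d t sd dt dD IH1 IH2 ps tq A B fA fB].
- have sub z : s < z < t -> p < z < q /\ z \notin D.
    move=> zst; split; last by apply/negP => /sD; rewrite zst.
    by case/andP: zst => sz zt; rewrite (le_lt_trans ps sz) (lt_le_trans zt tq).
  apply: (@derive_ge0_le_lim _ f df s t) => //.
    by move=> z /sub[zpq zD]; exact: fd.
  by move=> z /sub[zpq zD]; exact: fge.
- have dpq : p < d < q by rewrite (le_lt_trans ps sd) (lt_le_trans dt tq).
  have [l [r [fl fr lr]]] := fj d dpq dD.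
  have Al := IH1 ps (ltW (lt_le_trans dt tq)) _ _ fA fl.
  have rB := IH2 (ltW (le_lt_trans ps sd)) tq _ _ fr fB.
  exact: le_trans Al (le_trans lr rB).
Qed.

Lemma is_derive_add (R : realType) (f g : R -> R) (t df dg : R) :
  is_derive t 1 f df -> is_derive t 1 g dg ->
  is_derive t 1 (fun x => f x + g x) (df + dg).
Proof. by move=> ? ?; exact: is_deriveD. Qed.

Lemma is_derive_opp (R : realType) (f : R -> R) (t df : R) :
  is_derive t 1 f df -> is_derive t 1 (fun x => - f x) (- df).
Proof. by move=> ?; exact: is_deriveN. Qed.

Lemma is_derive_scale (R : realType) (k : R) (f : R -> R) (t df : R) :
  is_derive t 1 f df -> is_derive t 1 (fun x => k * f x) (k * df).
Proof. by move=> ?; exact: is_deriveZ. Qed.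

Lemma is_derive_mul (R : realType) (f g : R -> R) (t df dg : R) :
  is_derive t 1 f df -> is_derive t 1 g dg ->
  is_derive t 1 (fun x => f x * g x) (df * g t + f t * dg).
Proof.
move=> fd gd; apply: is_derive_eq (is_deriveM fd gd) _.
by rewrite /GRing.scale/= addrC mulrC.
Qed.

Lemma is_derive_div (R : realType) (f g : R -> R) (t df dg : R) : g t != 0 ->
  is_derive t 1 f df -> is_derive t 1 g dg ->
  is_derive t 1 (fun x => f x / g x) ((df * g t - f t * dg) / g t ^+ 2).
Proof.
move=> gt0 fd gd; apply: is_derive_eq (is_derive_mul fd (is_deriveV gt0 gd)) _.
by rewrite /GRing.scale/=; field.
Qed.

Lemma is_derive_expR_comp (R : realType) (f : R -> R) (t df : R) :
  is_derive t 1 f df -> is_derive t 1 (fun x => expR (f x)) (expR (f t) * df).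
Proof. by move=> ?; exact: is_derive1_comp. Qed.

Lemma is_derive_continuous (R : realType) (f : R -> R) (t df : R) :
  is_derive t 1 f df -> {for t, continuous f}.
Proof. by move=> [? _]; exact/differentiable_continuous/derivable1_diffP. Qed.

Lemma continuous_cvg_lr (R : realType) (f : R -> R) (t : R) :
  {for t, continuous f} ->
  f x @[x --> t^'-] --> f t /\ f x @[x --> t^'+] --> f t.
Proof. by move=> /left_right_continuousP. Qed.

(** [le_lim_jump] for a continuous function. *)
Lemma le_derive_ge0 (R : realType) (f df : R -> R) (D : seq R) (p q : R) :
  p <= q ->
  (forall t, p <= t <= q -> {for t, continuous f}) ->
  (forall t, p < t < q -> t \notin D -> is_derive t 1 f (df t)) ->
  (forall t, p < t < q -> t \notin D -> 0 <= df t) -> f p <= f q.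
Proof.
rewrite le_eqVlt => /predU1P[->//|pq] fc fd fge.
have := fc p; rewrite lexx (ltW pq) => /(_ isT)/continuous_cvg_lr[_ fp].
have := fc q; rewrite lexx (ltW pq) => /(_ isT)/continuous_cvg_lr[fq _].
apply: (le_lim_jump (D := D) pq fd fge) fp fq => t /andP[pt tq] _.
exists (f t), (f t); have := fc t; rewrite (ltW pt) (ltW tq).
by move=> /(_ isT)/continuous_cvg_lr[].
Qed.

(** The last point before [m] at which [y] is nonpositive. *)
Lemma last_nonpos (R : realType) (y : R -> R) (s m : R) : s <= m ->
  (forall t, s <= t <= m -> {for t, continuous y}) -> y s <= 0 -> 0 < y m ->
  exists t1, [/\ s <= t1, t1 < m, y t1 <= 0 & forall t, t1 < t <= m -> 0 < y t].
Proof.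
move=> sm yc ys ym.
pose S := [set t | s <= t <= m /\ y t <= 0].
have Ss : S s by split; rewrite ?lexx.
have Sub : ubound S m by move=> t [/andP[]].
have supS : has_sup S by split; [exists s|exists m].
have ubS t : S t -> t <= sup S by exact: sup_upper_bound.
have m1 : sup S <= m by apply: ge_sup => //; exists s.
have y1 : y (sup S) <= 0.
  rewrite leNgt; apply/negP => yS.
  have := yc (sup S); rewrite ubS// m1 => /(_ isT) cS.
  have [e /= e0 He] := cvgr_gt _ cS _ yS.
  have [t St tS] := sup_adherent e0 supS.
  have := He t; rewrite /ball_ /= ger0_norm ?subr_ge0 ?ubS// ltrBlDl -ltrBlDr.
  by move=> /(_ tS); case: St => _; rewrite leNgt => /negP.
exists (sup S); split => //; first exact: ubS.
  by rewrite lt_neqAle m1 andbT; apply: contraTneq ym => <-; rewrite -leNgt.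
move=> t /andP[St tm]; rewrite ltNge; apply/negP => yt.
have : S t by split; rewrite // tm (le_trans (ubS _ Ss) (ltW St)).
by move=> /ubS; rewrite leNgt St.
Qed.

(** The first point after [m] at which [y] is nonpositive. *)
Lemma first_nonpos (R : realType) (y : R -> R) (m e : R) : m <= e ->
  (forall t, m <= t <= e -> {for t, continuous y}) -> y e <= 0 -> 0 < y m ->
  exists t2, [/\ m < t2, t2 <= e, y t2 <= 0 & forall t, m <= t < t2 -> 0 < y t].
Proof.
move=> me yc ye ym.
have [||||t1 [t1e t1m yt1 yt]] := @last_nonpos R (y \o -%R) (- e) (- m).
- by rewrite lerN2.
- move=> t; rewrite lerNl lerNr => /andP[te mt].
  apply: continuous_comp; first exact: opp_continuous.
  by apply: yc; rewrite te mt.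
- by rewrite /= opprK.
- by rewrite /= opprK.
exists (- t1); split => //; [by rewrite ltrNr|by rewrite lerNl|].
move=> t /andP[mt tt]; have := yt (- t); rewrite /= opprK; apply.
by rewrite ltrNr tt lerN2.
Qed.

(** * A Lyapunov inequality on an interval between two zeros *)

(** The arithmetic core of the inequality: for [k1 = M / p] and [k2 = M / q] the
conclusion reads [4 <= (1/p + 1/q) (p + q)]. *)
Lemma four_le_mul_add (R : realType) (M k1 k2 p q : R) : 0 < M ->
  0 <= k1 -> 0 <= k2 -> 0 <= p -> 0 <= q ->
  M <= k1 * p -> M <= k2 * q -> 4 * M <= (k1 + k2) * (p + q).
Proof.
move=> M0 k10 k20 p0 q0 H1 H2.
suff H3 : 2 * M <= k1 * q + k2 * p.
  have -> : (k1 + k2) * (p + q) = k1 * p + k2 * q + (k1 * q + k2 * p) by ring.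
  by lra.
rewrite -ler_sqr ?nnegrE; last 2 first.
- by rewrite mulr_ge0 ?ltW.
- by rewrite addr_ge0 ?mulr_ge0.
have := ler_pM (ltW M0) (ltW M0) H1 H2.
have := sqr_ge0 (k1 * q - k2 * p).
by nra.
Qed.

(** [(y, w)] solves the system [y' = exp (-2A) b w], [w' = - exp (2A) c y] on
the open interval from [s] to [e] off the points of [D]; [y] is continuous,
and at a point of [D] where [w] jumps by [- k exp (2A) y] the function [C]
jumps by the positive part of [k]. *)
Definition reduced_solution (R : realType) (A b c C : R -> R) (D : seq R)
    (s e : R) (y w : R -> R) : Prop :=
  [/\ forall t, s <= t <= e -> {for t, continuous y},
      forall t, s < t < e -> t \notin D ->
        is_derive t 1 y (expR (- (2 * A t)) * (b t * w t)),
      forall t, s < t < e -> t \notin D ->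
        is_derive t 1 w (- (expR (2 * A t) * (c t * y t)))
    & forall t, s < t < e -> t \in D -> exists wl wr cl cr k,
        [/\ w x @[x --> t^'-] --> wl, w x @[x --> t^'+] --> wr,
            C x @[x --> t^'-] --> cl, C x @[x --> t^'+] --> cr &
            wr = wl - k * (expR (2 * A t) * y t) /\ cr = cl + Num.max k 0]].

Lemma reduced_solution_opp (R : realType) (A b c C : R -> R) (D : seq R)
    (s e : R) (y w : R -> R) :
  reduced_solution A b c C D s e y w ->
  reduced_solution A b c C D s e (fun t => - y t) (fun t => - w t).
Proof.
move=> [yc yd wd jump]; split.
- by move=> t /yc ?; exact: cvgN.
- by move=> t tse tD; rewrite !mulrN; exact: is_derive_opp (yd t tse tD).
- by move=> t tse tD; rewrite !mulrN; exact: is_derive_opp (wd t tse tD).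
- move=> t tse tD; have [wl [wr [cl [cr [k [wl' wr' cl' cr' [Ew Ec]]]]]]] :=
    jump t tse tD.
  exists (- wl), (- wr), cl, cr, k; split=> //; try exact: cvgN.
  by rewrite Ew !mulrN opprB opprK addrC.
Qed.

Section lyapunov.
Variables (R : realType) (a b c A Ab P C : R -> R) (D : seq R).
Variables (s e cs ce : R).
Hypothesis se : s < e.
Hypotheses (Ac : continuous A) (Abc : continuous Ab) (Pc : continuous P).
Hypothesis prim : forall t, s < t < e -> t \notin D ->
  [/\ is_derive t 1 A (a t), is_derive t 1 Ab `|a t|, is_derive t 1 P (b t),
      is_derive t 1 C (Num.max (c t) 0) & 0 <= b t].
(* [C] may jump at [s] and at [e]; only its limits from the inside count. *)
Hypothesis Cs : C x @[x --> s^'+] --> cs.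
Hypothesis Ce : C x @[x --> e^'-] --> ce.

Section positive_somewhere.
Variables (y w : R -> R).
Hypothesis sol : reduced_solution A b c C D s e y w.
Hypotheses (ys : y s = 0) (ye : y e = 0).

Let yc : forall t, s <= t <= e -> {for t, continuous y}.
Proof. by case: sol. Qed.

Let yd : forall t, s < t < e -> t \notin D ->
  is_derive t 1 y (expR (- (2 * A t)) * (b t * w t)).
Proof. by case: sol. Qed.

Let wd : forall t, s < t < e -> t \notin D ->
  is_derive t 1 w (- (expR (2 * A t) * (c t * y t))).
Proof. by case: sol. Qed.

Let jump : forall t, s < t < e -> t \in D -> exists wl wr cl cr k,
  [/\ w x @[x --> t^'-] --> wl, w x @[x --> t^'+] --> wr,
      C x @[x --> t^'-] --> cl, C x @[x --> t^'+] --> cr &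
      wr = wl - k * (expR (2 * A t) * y t) /\ cr = cl + Num.max k 0].
Proof. by case: sol. Qed.

(* Bounds of [A] on [[s, e]]: [A s] minus the negative variation of [A] and
   [A s] plus its positive variation; they differ by [Ab e - Ab s]. *)
Let Alow := A s - ((Ab e - A e) - (Ab s - A s)) / 2.
Let Aupp := A s + ((Ab e + A e) - (Ab s + A s)) / 2.

Let A_bound t : s <= t <= e -> Alow <= A t <= Aupp.
Proof.
have addc p q : continuous (fun x => Ab x + p * A x).
  move=> x; apply: cvgD; first exact: Abc.
  by apply: cvgM; [exact: cvg_cst|exact: Ac].
have addd p z : s < z < e -> z \notin D ->
    is_derive z 1 (fun x => Ab x + p * A x) (`|a z| + p * a z).
  move=> zse zD; have [dA dAb _ _ _] := prim zse zD.
  by apply: is_derive_add => //; exact: is_derive_scale.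
have mono p u v : `|p| <= 1 -> s <= u -> u <= v -> v <= e ->
    Ab u + p * A u <= Ab v + p * A v.
  move=> p1 su uv ve.
  apply: (@le_derive_ge0 R (fun x => Ab x + p * A x)
    (fun x => `|a x| + p * a x) D) => //.
  - by move=> z _; exact: addc.
  - move=> z /andP[uz zv] zD; apply: addd => //.
    by rewrite (le_lt_trans su uz) (lt_le_trans zv ve).
  - move=> z _ _; rewrite -lerBlDr sub0r (le_trans (ler_norm _))// normrN normrM.
    by rewrite -[leRHS]mul1r ler_wpM2r.
have p1 : `|1 : R| <= 1 by rewrite normr1.
have n1 : `|-1 : R| <= 1 by rewrite normrN normr1.
move=> /andP[st te].
have := mono _ _ _ p1 (lexx s) st te; have := mono _ _ _ p1 st te (lexx e).
have := mono _ _ _ n1 (lexx s) st te; have := mono _ _ _ n1 st te (lexx e).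
rewrite /Alow /Aupp; lra.
Qed.

Let lims t : s < t < e -> exists wl wr cl cr k,
  [/\ w x @[x --> t^'-] --> wl, w x @[x --> t^'+] --> wr,
      C x @[x --> t^'-] --> cl, C x @[x --> t^'+] --> cr &
      wr = wl - k * (expR (2 * A t) * y t) /\ cr = cl + Num.max k 0].
Proof.
move=> tse; have [/jump|tD] := boolP (t \in D); first exact.
have [_ _ _ dC _] := prim tse tD.
have [wl wr] := continuous_cvg_lr (is_derive_continuous (wd tse tD)).
have [cl cr] := continuous_cvg_lr (is_derive_continuous dC).
exists (w t), (w t), (C t), (C t), 0; split=> //.
by rewrite mul0r subr0 maxxx addr0.
Qed.

Let C_mono u v l r : s <= u -> u < v -> v <= e ->
  C x @[x --> u^'+] --> l -> C x @[x --> v^'-] --> r -> l <= r.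
Proof.
move=> su uv ve.
have sub z : u < z < v -> s < z < e.
  by move=> /andP[uz zv]; rewrite (le_lt_trans su uz) (lt_le_trans zv ve).
apply: (@le_lim_jump R C (fun x => Num.max (c x) 0) D u v) => // z /sub zse zD.
- by case: (prim zse zD).
- by rewrite le_max lexx orbT.
- have [_ [_ [cl [cr [k [_ _ ? ? [_ Ec]]]]]]] := lims zse.
  by exists cl, cr; split=> //; rewrite Ec lerDl le_max lexx orbT.
Qed.

Let C_bound t : s < t < e -> t \notin D -> cs <= C t <= ce.
Proof.
move=> tse tD; have [_ _ _ dC _] := prim tse tD.
have [cl cr] := continuous_cvg_lr (is_derive_continuous dC).
case/andP: tse => st te.
by rewrite (C_mono _ _ _ Cs cl) ?(C_mono _ _ _ cr Ce)// ltW.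
Qed.

(** The inequality when [y] is positive somewhere. *)
Lemma lyapunov_pos m0 : s <= m0 <= e -> 0 < y m0 ->
  4 <= expR (2 * (Ab e - Ab s)) * (P e - P s) * (ce - cs).
Proof.
move=> m0se ym0.
have cy : {within `[s, e], continuous y}.
  by apply: continuous_in_subspaceT => z; rewrite inE/= in_itv/=; exact: yc.
have [m mse ymax] := EVT_max (ltW se) cy.
set M := y m in ymax.
have M0 : 0 < M by rewrite (lt_le_trans ym0)// ymax// in_itv.
move: mse; rewrite in_itv/= => /andP[sm me].
have {}sm : s < m.
  rewrite lt_neqAle sm andbT; apply: contraTneq M0 => sm'.
  by rewrite /M -sm' ys ltxx.
have {}me : m < e.
  rewrite lt_neqAle me andbT; apply: contraTneq M0 => sm'.
  by rewrite /M sm' ye ltxx.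
(* [y] is positive between [t1] and [t2], with [y t1 <= 0] and [y t2 <= 0]. *)
have [||||t1 [st1 t1m yt1 pos1]] := @last_nonpos R y s m => //; first exact: ltW.
- by move=> t /andP[st tm]; apply: yc; rewrite st (le_trans tm (ltW me)).
- by rewrite ys.
have [||||t2 [mt2 t2e yt2 pos2]] := @first_nonpos R y m e => //; first exact: ltW.
- by move=> t /andP[mt te]; apply: yc; rewrite te (le_trans (ltW sm) mt).
- by rewrite ye.
have sub t : t1 < t < t2 -> s < t < e.
  by move=> /andP[? ?]; rewrite (le_lt_trans st1)//= (lt_le_trans _ t2e).
have y_ge0 t : t1 < t < t2 -> 0 <= y t <= M.
  move=> tt; have /andP[st te] := sub _ tt; case/andP: tt => tt1 tt2.
  rewrite ymax ?in_itv/= ?ltW//; have [tm|/ltW tm] := leP t m.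
    by rewrite pos1// tt1.
  by rewrite pos2// tt2 tm.
pose E := expR (2 * Aupp); pose E' := expR (- (2 * Alow)).
have E0 : 0 < E by exact: expR_gt0.
have E'0 : 0 < E' by exact: expR_gt0.
have EA t : s < t < e -> expR (2 * A t) <= E.
  move=> /andP[/ltW st /ltW te]; rewrite ler_expR ler_pM2l//.
  by have := @A_bound t; rewrite st te => /(_ isT)/andP[].
have E'A t : s < t < e -> expR (- (2 * A t)) <= E'.
  move=> /andP[/ltW st /ltW te]; rewrite ler_expR lerN2 ler_pM2l//.
  by have := @A_bound t; rewrite st te => /(_ isT)/andP[].
(* [w] cannot decrease faster than [M * E * C] increases. *)
pose h := fun t => w t + M * E * C t.
pose dh := fun t => - (expR (2 * A t) * (c t * y t)) + M * E * Num.max (c t) 0.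
have jump_ge0 t k : t1 < t < t2 ->
    0 <= - (expR (2 * A t) * (k * y t)) + M * E * Num.max k 0.
  move=> tt; have /andP[y0 yM] := y_ge0 _ tt.
  have := EA _ (sub _ tt); have := expR_gt0 (2 * A t).
  rewrite addrC subr_ge0 mulrCA => e0 eE.
  apply: (@le_trans _ _ (Num.max k 0 * (expR (2 * A t) * y t))).
    apply: ler_wpM2r; first by rewrite mulr_ge0// ltW.
    by rewrite le_max lexx.
  rewrite mulrC ler_wpM2r ?le_max ?lexx ?orbT// mulrC ler_pM// ltW//.
have h_mono u v A' B' : t1 <= u -> u < v -> v <= t2 ->
    h x @[x --> u^'+] --> A' -> h x @[x --> v^'-] --> B' -> A' <= B'.
  move=> su uv ve.
  have sub' z : u < z < v -> t1 < z < t2.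
    by move=> /andP[uz zv]; rewrite (le_lt_trans su uz) (lt_le_trans zv ve).
  apply: (@le_lim_jump R h dh D u v) => // z /sub' zt zD.
  - have [_ _ _ dC _] := prim (sub _ zt) zD.
    exact: is_derive_add (wd (sub _ zt) zD) (is_derive_scale _ dC).
  - exact: jump_ge0.
  - have [wl [wr [cl [cr [k [wl' wr' cl' cr' [Ew Ec]]]]]]] := lims (sub _ zt).
    exists (wl + M * E * cl), (wr + M * E * cr); split.
    + by apply: cvgD => //; apply: cvgM => //; exact: cvg_cst.
    + by apply: cvgD => //; apply: cvgM => //; exact: cvg_cst.
    + rewrite Ew Ec; have := jump_ge0 _ k zt; lra.
have mt : t1 < m < t2 by rewrite t1m mt2.
have [wl [wr [cl [cr [k [wl' wr' cl' cr' [Ew Ec]]]]]]] := lims (sub _ mt).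
have hl : h x @[x --> m^'-] --> wl + M * E * cl.
  by apply: cvgD => //; apply: cvgM => //; exact: cvg_cst.
pose om := wr + M * E * cr.
have hr : h x @[x --> m^'+] --> om.
  by apply: cvgD => //; apply: cvgM => //; exact: cvg_cst.
have hlr : wl + M * E * cl <= om.
  rewrite /om Ew Ec; have := jump_ge0 _ k mt; lra.
have hc t : t1 < t < t2 -> t \notin D -> {for t, continuous h}.
  move=> tt tD; have [_ _ _ dC _] := prim (sub _ tt) tD.
  exact: is_derive_continuous
    (is_derive_add (wd (sub _ tt) tD) (is_derive_scale _ dC)).
(* Upper bounds of [w] on the left and of [- w] on the right of the maximum;
   truncation at [0] makes them usable as factors before [P]. *)
pose k1 := Num.max (om - M * E * cs) 0.
pose k2 := Num.max (M * E * ce - om) 0.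
have w1 t : t1 < t < m -> t \notin D -> w t <= k1.
  move=> /andP[tt1 tm] tD; have tt : t1 < t < t2 by rewrite tt1 (lt_trans tm).
  have [_ hcr] := continuous_cvg_lr (hc _ tt tD).
  have := h_mono _ _ _ _ (ltW tt1) tm (ltW mt2) hcr hl.
  have /andP[csC _] := C_bound (sub _ tt) tD.
  have : M * E * cs <= M * E * C t by rewrite ler_pM2l// mulr_gt0.
  rewrite le_max /h => ? ?; apply/orP; left; lra.
have w2 t : m < t < t2 -> t \notin D -> - w t <= k2.
  move=> /andP[mt' tt2] tD; have tt : t1 < t < t2 by rewrite tt2 (lt_trans t1m).
  have [hcl _] := continuous_cvg_lr (hc _ tt tD).
  have := h_mono _ _ _ _ (ltW t1m) mt' (ltW tt2) hr hcl.
  have /andP[_ Cce] := C_bound (sub _ tt) tD.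
  have : M * E * C t <= M * E * ce by rewrite ler_pM2l// mulr_gt0.
  rewrite le_max /h => ? ?; apply/orP; left; lra.
have k10 : 0 <= k1 by rewrite le_max lexx orbT.
have k20 : 0 <= k2 by rewrite le_max lexx orbT.
have P_mono u v : s <= u -> u <= v -> v <= e -> P u <= P v.
  move=> su uv ve.
  have sub' z : u < z < v -> s < z < e.
    by move=> /andP[uz zv]; rewrite (le_lt_trans su uz) (lt_le_trans zv ve).
  apply: (@le_derive_ge0 R P b D) => // [z _|z /sub' zse zD|z /sub' zse zD].
  - exact: Pc.
  - by case: (prim zse zD).
  - by case: (prim zse zD).
have bw t k' v : s < t < e -> t \notin D -> v <= k' -> 0 <= k' ->
    expR (- (2 * A t)) * (b t * v) <= k' * E' * b t.
  move=> tse tD vk k0; have [_ _ _ _ b0] := prim tse tD.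
  have -> : k' * E' * b t = E' * (b t * k') by ring.
  apply: (@le_trans _ _ (expR (- (2 * A t)) * (b t * k'))).
    by rewrite ler_pM2l ?expR_gt0// ler_wpM2l.
  by rewrite ler_wpM2r ?E'A// mulr_ge0.
(* Integrating [y'] from [t1] to [m], then from [m] to [t2]. *)
have H1 : M <= k1 * (E' * (P m - P t1)).
  have : k1 * E' * P t1 + - y t1 <= k1 * E' * P m + - y m.
    apply: (@le_derive_ge0 R (fun x => k1 * E' * P x + - y x)
      (fun t => k1 * E' * b t + - (expR (- (2 * A t)) * (b t * w t))) D).
    - exact: ltW.
    - move=> t /andP[tt1 tm]; apply: cvgD.
        by apply: cvgM; [exact: cvg_cst|exact: Pc].
      apply: cvgN; apply: yc.
      by rewrite (le_trans st1 tt1) (le_trans tm (ltW me)).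
    - move=> t /andP[tt1 tm] tD.
      have /sub tse : t1 < t < t2 by rewrite tt1 (lt_trans tm).
      have [_ _ dP _ _] := prim tse tD.
      exact: is_derive_add (is_derive_scale _ dP) (is_derive_opp (yd tse tD)).
    - move=> t /andP[tt1 tm] tD.
      have /sub tse : t1 < t < t2 by rewrite tt1 (lt_trans tm).
      by rewrite subr_ge0 bw// w1// tt1.
  rewrite -/M; lra.
have H2 : M <= k2 * (E' * (P t2 - P m)).
  have : k2 * E' * P m + y m <= k2 * E' * P t2 + y t2.
    apply: (@le_derive_ge0 R (fun x => k2 * E' * P x + y x)
      (fun t => k2 * E' * b t + (expR (- (2 * A t)) * (b t * w t))) D).
    - exact: ltW.
    - move=> t /andP[tm tt2]; apply: cvgD.
        by apply: cvgM; [exact: cvg_cst|exact: Pc].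
      apply: yc; by rewrite (le_trans tt2 t2e) (le_trans (ltW sm) tm).
    - move=> t /andP[tm tt2] tD.
      have /sub tse : t1 < t < t2 by rewrite tt2 (lt_trans t1m).
      have [_ _ dP _ _] := prim tse tD.
      exact: is_derive_add (is_derive_scale _ dP) (yd tse tD).
    - move=> t /andP[tm tt2] tD.
      have /sub tse : t1 < t < t2 by rewrite tt2 (lt_trans t1m).
      have := bw t k2 (- w t) tse tD; rewrite w2 ?tm// !mulrN => /(_ isT k20).
      lra.
  rewrite -/M; lra.
have p0 : 0 <= P m - P t1 by rewrite subr_ge0 P_mono// ltW.
have q0 : 0 <= P t2 - P m by rewrite subr_ge0 P_mono// ltW.
have := four_le_mul_add M0 k10 k20
  (mulr_ge0 (ltW E'0) p0) (mulr_ge0 (ltW E'0) q0) H1 H2.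
(* The truncations are inactive, because [M] is positive. *)
have pos_max z p : 0 <= p -> M <= Num.max z 0 * p -> Num.max z 0 = z.
  move=> p0' H; apply/max_idPl; rewrite leNgt; apply/negP => z0.
  by move: H; rewrite (max_idPr (ltW z0)) mul0r leNgt M0.
have -> : k1 = om - M * E * cs by exact: pos_max (mulr_ge0 (ltW E'0) p0) H1.
have -> : k2 = M * E * ce - om by exact: pos_max (mulr_ge0 (ltW E'0) q0) H2.
have -> : om - M * E * cs + (M * E * ce - om) = M * (E * (ce - cs)) by ring.
rewrite -mulrDr => H.
have {}H : 4 <= (E * E') * (ce - cs) * (P t2 - P t1).
  rewrite -(ler_pM2l M0) mulrC; apply: le_trans H _.
  by rewrite le_eqVlt; apply/orP; left; apply/eqP; ring.
have EE : E * E' = expR (2 * (Ab e - Ab s)).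
  rewrite /E /E' -expRD; congr expR; rewrite /Aupp /Alow; lra.
rewrite EE in H.
have Pt : 0 <= P t2 - P t1 by lra.
have Ps1 : P s <= P t1 by apply: P_mono => //; rewrite ltW// (lt_trans t1m).
have Pe2 : P t2 <= P e by apply: P_mono => //; rewrite ltW// (lt_trans sm).
have cc : 0 <= ce - cs.
  by rewrite subr_ge0; exact: (C_mono (lexx s) se (lexx e) Cs Ce).
apply: le_trans H _; rewrite -!mulrA ler_pM2l ?expR_gt0// mulrC.
by rewrite ler_wpM2r// lerB.
Qed.

End positive_somewhere.

(** Lyapunov's inequality for a nonzero solution that vanishes at [s] and [e]. *)
Lemma lyapunov (y w : R -> R) (m : R) :
  reduced_solution A b c C D s e y w -> y s = 0 -> y e = 0 ->
  s <= m <= e -> y m != 0 ->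
  4 <= expR (2 * (Ab e - Ab s)) * (P e - P s) * (ce - cs).
Proof.
move=> sol ys ye mse; rewrite neq_lt => /orP[ym|ym]; last first.
  exact: lyapunov_pos sol ys ye _ mse ym.
apply: (lyapunov_pos (reduced_solution_opp sol) _ _ mse).
- by rewrite ys oppr0.
- by rewrite ye oppr0.
- by rewrite oppr_gt0.
Qed.

End lyapunov.

(** * Primitives of periodic functions *)

Section clamped_primitive.
Variables (R : realType) (T : R).
Hypothesis T_gt0 : 0 < T.
Notation mu := (@lebesgue_measure R).

(** The projection of the line onto [[0, T]]. *)
Definition clamp (t : R) : R := Num.max 0 (Num.min t T).

Lemma clamp_itv t : 0 <= clamp t <= T.
Proof. by rewrite /clamp le_max lexx /= ge_max ge_min lexx orbT ltW. Qed.

Lemma clamp_id t : 0 <= t <= T -> clamp t = t.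
Proof. by move=> /andP[t0 tT]; rewrite /clamp (min_idPl tT) (max_idPr t0). Qed.

Lemma clamp_le0 t : t <= 0 -> clamp t = 0.
Proof.
by move=> t0; rewrite /clamp (min_idPl (le_trans t0 (ltW T_gt0))) (max_idPl t0).
Qed.

Lemma clamp_geT t : T <= t -> clamp t = T.
Proof. by move=> tT; rewrite /clamp (min_idPr tT) (max_idPr (ltW T_gt0)). Qed.

Lemma clamp_continuous : continuous clamp.
Proof.
move=> t; apply: (@continuous_max R R (fun=> 0) (fun x => Num.min x T)).
  exact: cvg_cst.
by apply: (@continuous_min R R id (fun=> T)); [exact: cvg_id|exact: cvg_cst].
Qed.

(** The primitive of [f] on [[0, T]] that vanishes at [0], extended by
constants to the line. *)
Definition prim (f : R -> R) (t : R) : R :=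
  \int[mu]_(x in `[0, clamp t]) f x.

Lemma prim_le0 (f : R -> R) (t : R) : t <= 0 -> prim f t = 0.
Proof. by move=> t0; rewrite /prim clamp_le0// set_itv1 Rintegral_set1. Qed.

Lemma prim_geT (f : R -> R) (t : R) : T <= t ->
  prim f t = \int[mu]_(x in `[0, T]) f x.
Proof. by move=> tT; rewrite /prim clamp_geT. Qed.

Lemma prim_continuous (f : R -> R) : mu.-integrable `[0, T] (EFin \o f) ->
  continuous (prim f).
Proof.
move=> intf t.
have /subspace_continuousP cF :=
  parameterized_integral_continuous (ltW T_gt0) intf.
have ct : `[0, T]%classic (clamp t) by rewrite /= in_itv/=; exact: clamp_itv.
apply: (cvg_comp _ _ _ (cF (clamp t) ct)) => U /=.
rewrite /nbhs/= => HU; have cU := @clamp_continuous t _ HU.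
have {}cU : \forall x \near t, clamp x \in `[0, T] -> U (clamp x) by exact: cU.
suff : \forall x \near t, U (clamp x) by [].
by apply: filterS cU => x; apply; rewrite in_itv/=; exact: clamp_itv.
Qed.

Lemma is_derive_prim (f : R -> R) (t : R) :
  mu.-integrable `[0, T] (EFin \o f) ->
  0 < t < T -> {for t, continuous f} -> is_derive t 1 (prim f) (f t).
Proof.
move=> intf /andP[t0 tT] ft.
have [dF EF] := continuous_FTC1_closed tT intf t0 ft.
have FE : \forall x \near t, \int[mu]_(z in [set` `[0, x]]) f z = prim f x.
  near=> x; rewrite /prim clamp_id//; apply/andP; split; apply: ltW; near: x.
    exact: lt_nbhsr.
  exact: lt_nbhsl.
apply: near_eq_is_derive FE _.
by split; [exact: dF|rewrite -derive1E; exact: EF].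
Unshelve. all: by end_near. Qed.

Lemma is_derive_prim_gtT (f : R -> R) (t : R) : T < t ->
  is_derive t 1 (prim f) 0.
Proof.
move=> Tt; apply: near_eq_is_derive (is_derive_cst (prim f T) t 1).
by near=> x; rewrite !prim_geT//; apply: ltW; near: x; exact: lt_nbhsr.
Unshelve. all: by end_near. Qed.

(** A primitive on [[0, 2 T]] of the [T]-periodic function that agrees with
[f] on [[0, T]]. Both summands being constant outside their window, no case
distinction is needed; at [T] it is continuous, but differentiability there is
not claimed. *)
Definition prim2 (f : R -> R) (t : R) : R := prim f t + prim f (t - T).

Lemma prim2_continuous (f : R -> R) : mu.-integrable `[0, T] (EFin \o f) ->
  continuous (prim2 f).
Proof.
move=> intf t; apply: cvgD; first exact: prim_continuous.
apply: (@continuous_comp _ _ _ (fun x => x - T) (prim f)).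
  by apply: cvgB; [exact: cvg_id|exact: cvg_cst].
exact: prim_continuous.
Qed.

(** The integral over any period starting in [[0, T]] is that over [[0, T]]. *)
Lemma prim2_shift (f : R -> R) (t : R) : 0 <= t <= T ->
  prim2 f (t + T) - prim2 f t = \int[mu]_(x in `[0, T]) f x.
Proof.
move=> /andP[t0 tT]; rewrite /prim2 addrK.
rewrite (@prim_geT f (t + T)) ?lerDr// (@prim_le0 f (t - T)) ?subr_le0//.
ring.
Qed.

Lemma is_derive_prim2 (f : R -> R) (t : R) :
  mu.-integrable `[0, T] (EFin \o f) ->
  0 < t < T -> {for t, continuous f} -> is_derive t 1 (prim2 f) (f t).
Proof.
move=> intf tT ft; have d1 := is_derive_prim intf tT ft.
case/andP: tT => t0 tT.
apply: near_eq_is_derive d1; near=> x.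
rewrite /prim2 (@prim_le0 f (x - T)) ?addr0// subr_le0.
by apply: ltW; near: x; exact: lt_nbhsl.
Unshelve. all: by end_near. Qed.

Lemma is_derive_prim2_shift (f : R -> R) (t : R) :
  mu.-integrable `[0, T] (EFin \o f) ->
  T < t < T + T -> {for t - T, continuous f} ->
  is_derive t 1 (prim2 f) (f (t - T)).
Proof.
move=> intf /andP[Tt tT] ft.
have d1 : is_derive (t - T) 1 (prim f) (f (t - T)).
  by apply: is_derive_prim; rewrite // subr_gt0 Tt ltrBlDr.
have d2 : is_derive t 1 (fun x : R => x - T) 1.
  have := is_derive_add (is_derive_id t 1) (is_derive_cst (- T) t 1).
  by rewrite addr0.
have d3 : is_derive t 1 (prim f \o (fun x => x - T)) (f (t - T)).
  have := @is_derive1_comp R (prim f) (fun x => x - T) t _ _ d1 d2.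
  by rewrite mulr1.
have := is_derive_add (is_derive_prim_gtT f Tt) d3.
by rewrite add0r.
Qed.

End clamped_primitive.

(** * Piecewise continuous functions on an interval *)

Lemma bounded_gap (R : realType) (f : R -> R) (p q A B : R) : p < q ->
  (forall t, p < t < q -> {for t, continuous f}) ->
  f x @[x --> p^'+] --> A -> f x @[x --> q^'-] --> B ->
  exists M, forall t, p < t < q -> `|f t| <= M.
Proof.
move=> pq fc fA fB.
pose g t := if t <= p then A else if q <= t then B else f t.
have gf t : p < t < q -> g t = f t.
  by move=> /andP[pt tq]; rewrite /g leNgt pt leNgt tq.
have gc : {within `[p, q], continuous g}.
  apply/continuous_within_itvP => //; split.
  - move=> t; rewrite in_itv/= => tpq.
    have E : \forall x \near t, f x = g x.
      near=> x; rewrite gf//; near: x.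
      have := @near_in_itvoo R p q t; rewrite in_itv/= => /(_ tpq).
      by apply: filterS => x; rewrite in_itv.
    rewrite /continuous_at gf//; apply: cvg_trans (fc t tpq).
    by apply: near_eq_cvg; apply: filterS E => x ->.
  - rewrite {2}/g lexx; apply: cvg_trans fA; apply: near_eq_cvg.
    near=> x; rewrite gf//; apply/andP; split; near: x.
      exact: nbhs_right_gt.
    exact: nbhs_right_lt.
  - have -> : g q = B by rewrite /g leNgt pq lexx.
    apply: cvg_trans fB; apply: near_eq_cvg.
    near=> x; rewrite gf//; apply/andP; split; near: x.
      exact: nbhs_left_gt.
    exact: nbhs_left_lt.
have [u _ gu] := EVT_max (ltW pq) gc.
have [v _ gv] := EVT_min (ltW pq) gc.
exists (Num.max (g u) (- g v)) => t tpq; have tpq' : t \in `[p, q].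
  by rewrite in_itv/= !ltW//; case/andP: tpq.
rewrite -gf// ler_norml lerNl !le_max gu// lerN2 gv// orbT//.
Unshelve. all: by end_near. Qed.

Section piecewise_continuous.
Variables (R : realType) (T : R) (D : seq R) (f : R -> R).
Hypothesis T_gt0 : 0 < T.
Notation mu := (@lebesgue_measure R).

(** The values of [f] at the exceptional points are arbitrary, but finitely many,
so that [f] is bounded on the whole interval. *)
Lemma bounded_piecewise :
  (forall t, 0 < t < T -> t \notin D -> {for t, continuous f}) ->
  (forall t, 0 <= t < T -> cvg (f x @[x --> t^'+])) ->
  (forall t, 0 < t <= T -> cvg (f x @[x --> t^'-])) ->
  exists M, forall t, 0 <= t <= T -> `|f t| <= M.
Proof.
move=> fc fr fl.
pose Q p q := 0 <= p -> q <= T ->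
  exists M, forall t, p < t < q -> t \notin D -> `|f t| <= M.
have chain : forall p q, p < q -> Q p q.
  refine (@interval_chain R Q D _ _) =>
    [p q pq pqD p0 qT|p d q pd dq dD IH1 IH2 p0 qT].
- have [l fp] : exists l : R, f x @[x --> p^'+] --> l.
    by apply/cvg_ex; apply: fr; rewrite p0 (lt_le_trans pq).
  have [l' fq] : exists l : R, f x @[x --> q^'-] --> l.
    by apply/cvg_ex; apply: fl; rewrite qT (le_lt_trans p0).
  have [|M HM] := @bounded_gap R f p q _ _ pq _ fp fq.
    move=> t tpq; apply: fc; last by apply/negP => /pqD; rewrite tpq.
    by case/andP: tpq => pt tq; rewrite (le_lt_trans p0 pt) (lt_le_trans tq qT).
  by exists M => t + _; exact: HM.
- have [M1 H1] := IH1 p0 (ltW (lt_le_trans dq qT)).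
  have [M2 H2] := IH2 (ltW (le_lt_trans p0 pd)) qT.
  exists (Num.max M1 M2) => t /andP[pt tq] tD; rewrite le_max.
  case: (ltgtP t d) => [td|dt|td].
  - by rewrite H1// pt.
  - by rewrite (H2 t)// ?dt// orbT.
  - by rewrite td dD in tD.
have [M HM] := chain 0 T T_gt0 (lexx 0) (lexx T).
exists (\big[Num.max/M]_(d <- 0 :: T :: D) `|f d|) => t /andP[t0 tT].
have [tD|] := boolP (t \in 0 :: T :: D).
  exact: (le_bigmax_seq _ _ xpredT (fun d => `|f d|)).
rewrite !inE !negb_or => /and3P[tn0 tnT tD].
apply: (@le_trans _ _ M); last exact: bigmax_ge_id.
by apply: HM; rewrite // !lt_neqAle tnT t0 tT eq_sym tn0.
Qed.

Lemma measurable_fun_piecewise :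
  (forall t, 0 < t < T -> t \notin D -> {for t, continuous f}) ->
  measurable_fun `[0, T] f.
Proof.
move=> fc.
pose U := `]0, T[%classic `\` [set` D].
pose F := [set` 0 :: T :: D].
have cF (s : seq R) : countable [set` s].
  exact/finite_set_countable/finite_seq.
have mF (A : set R) : A `<=` F -> measurable A.
  move=> AF; apply: countable_measurable => //.
  exact: sub_countable (subset_card_le AF) (cF _).
have UF : `[0, T]%classic `<=` U `|` F.
  move=> t; rewrite /= in_itv/= => /andP[t0 tT].
  have [tD|] := boolP (t \in 0 :: T :: D); first by right.
  rewrite !inE !negb_or => /and3P[tn0 tnT tD]; left; split; last exact/negP.
  by rewrite /= in_itv/= !lt_neqAle tnT t0 tT eq_sym tn0.
have oU : open U.
  apply: openI; first exact: interval_open.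
  apply: closed_openC.
  have /accessible_finite_set_closed := hausdorff_accessible (@Rhausdorff R).
  by apply; exact: finite_seq.
have mU : measurable U by exact: measurable_realfun.open_measurable.
apply: measurable_funS UF _; first by apply: measurableU => //; exact: mF.
apply/measurable_funU => //; first exact: mF.
split; last by move=> mFF Y mY; apply: mF; exact: subIsetl.
apply: measurable_realfun.open_continuous_measurable_fun => // t; rewrite inE => -[].
by rewrite /= in_itv/= => t0T /negP tD; exact: fc.
Qed.

Lemma integrable_bounded M : measurable_fun `[0, T] f ->
  (forall t, 0 <= t <= T -> `|f t| <= M) ->
  mu.-integrable `[0, T] (EFin \o f).
Proof.
move=> mf fM; apply: measurable_bounded_integrable => //.
  by rewrite /= lebesgue_measure_itv/=; case: ifP => _; rewrite ltry.
exists M; split; first exact: num_real.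
by move=> x Mx t; rewrite /= in_itv/= => /fM /le_trans; apply; exact: ltW.
Qed.

End piecewise_continuous.

(** * Impulse points *)

Section impulse_points.
Variables (R : realType) (T : R) (r : nat) (tau : int -> R).
Hypotheses (T_gt0 : 0 < T) (r_gt0 : (0 < r)%N).
Hypothesis tau_lt : forall i : int, tau i < tau (i + 1).
Hypothesis tau_per : forall i : int, tau (i + r%:Z) = tau i + T.

Lemma tau_addn (i : int) (n : nat) : tau (i + (n * r)%N%:Z) = tau i + T *+ n.
Proof.
elim: n => [|n IH]; first by rewrite mul0n addr0 mulr0n addr0.
by rewrite mulSn addnC PoszD addrA tau_per IH -addrA mulrSr.
Qed.

Lemma tau_homo : {homo tau : i j / (i < j)%R}.
Proof.
move=> i j ij; have [n ->] : exists n : nat, j = i + n.+1%:Z.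
  exists (`|j - i|%N.-1); rewrite prednK ?absz_gt0 ?subr_eq0 ?gt_eqF//.
  by rewrite gtz0_abs ?subr_gt0//; ring.
elim: n => [|n IH]; first exact: tau_lt.
by apply: lt_trans IH _; rewrite -(addn1 n.+1) PoszD addrA; exact: tau_lt.
Qed.

Lemma tau_inj : injective tau.
Proof.
move=> i j; have [ij|ji|//] := ltgtP i j.
  by move=> E; have := tau_homo ij; rewrite E ltxx.
by move=> E; have := tau_homo ji; rewrite E ltxx.
Qed.

Lemma ltr_tau i j : (tau i < tau j) = (i < j).
Proof.
have [ij|ji|->] := ltgtP i j; last by rewrite ltxx.
  by rewrite tau_homo.
by apply/negbTE; rewrite -leNgt ltW// tau_homo.
Qed.

Lemma range_tau_shift t : range tau (t + T) <-> range tau t.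
Proof.
split => -[i _ E]; last by exists (i + r%:Z) => //; rewrite tau_per E.
by exists (i - r%:Z) => //; apply: (addIr T); rewrite -tau_per subrK.
Qed.

Lemma tau_locally_finite (s e : R) :
  exists D : seq R, forall t, s <= t <= e -> range tau t -> t \in D.
Proof.
have big x : exists n : nat, x < T *+ n.
  exists (Num.bound `|x / T|); rewrite -mulr_natl -ltr_pdivrMr//.
  exact: le_lt_trans (ler_norm _) (archi_boundP (normr_ge0 _)).
have [m Hm] := big (e - tau 0); have [n Hn] := big (tau 0 - s).
exists [seq tau (i%:Z - (n * r)%N%:Z) | i <- iota 0 (n * r + m * r)].
move=> t /andP[st te] [i _ E]; rewrite -E in st te *.
have im : (i < (m * r)%N%:Z).
  by rewrite -ltr_tau -[(m * r)%N%:Z]add0r tau_addn (le_lt_trans te)// -ltrBlDl.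
have i_n : (- (n * r)%N%:Z < i).
  rewrite -ltr_tau -(ltrD2r (T *+ n)) -tau_addn addNr.
  by move: Hn st; set z := T *+ n; lra.
apply/mapP; exists (`|(i + (n * r)%N%:Z)%R|%N); last first.
  by rewrite gez0_abs ?addrK//; lia.
by rewrite mem_iota /= add0n; lia.
Qed.

Lemma near_off_tau t : \forall x \near t, x != t -> ~ range tau x.
Proof.
have [D HD] := tau_locally_finite (t - 1) (t + 1).
have nD (l : seq R) : \forall x \near t, x != t -> x \notin l.
  elim: l => [|d l IH]; first by near=> x; rewrite in_nil.
  have [->|td] := eqVneq d t.
    by apply: filterS IH => x H xd; rewrite inE negb_or xd H.
  near=> x => xt; rewrite inE negb_or (near IH x)// andbT.
  near: x; have [td'|td'] := ltP t d.
    by apply: filterS (lt_nbhsl td') => x /lt_eqF->.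
  have {}td' : d < t by rewrite lt_neqAle td.
  by apply: filterS (lt_nbhsr td') => x /gt_eqF->.
near=> x => xt rx; have : x \notin D by apply: (near (nD D)).
move/negP; apply; apply: HD => //; apply/andP; split; apply: ltW; near: x.
  by apply: lt_nbhsr; rewrite gtrBl.
by apply: lt_nbhsl; rewrite ltrDl.
Unshelve. all: by end_near. Qed.

Lemma near_off_range t : ~ range tau t -> \forall x \near t, ~ range tau x.
Proof.
move=> nt; apply: filterS (near_off_tau t) => x H.
by have [->//|] := eqVneq x t.
Qed.

End impulse_points.

Section order_near.
Variables (R : realType) (d : nat -> R).

(** Near [t], the points [d i] to the left of [x] are, according to the side on
which [x] lies, those to the left of [t] or those not to the right of [t]. *)
Lemma near_ltl (n : nat) t : \forall x \near t^'-,
  forall i, (i < n)%N -> (d i < x) = (d i < t).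
Proof.
elim: n => [|n IH]; first by near=> x.
have H : \forall x \near t^'-, (d n < x) = (d n < t).
  have [dt|td] := ltP (d n) t.
    by apply: filterS (nbhs_left_gt dt) => x ->.
  apply: filterS (nbhs_left_lt t) => x xt; apply/negbTE.
  by rewrite -leNgt ltW// (lt_le_trans xt).
near=> x => i; rewrite ltnS leq_eqVlt => /predU1P[->|]; first by near: x.
exact: (near IH).
Unshelve. all: by end_near. Qed.

Lemma near_ltr (n : nat) t : \forall x \near t^'+,
  forall i, (i < n)%N -> (d i < x) = (d i <= t).
Proof.
elim: n => [|n IH]; first by near=> x.
have H : \forall x \near t^'+, (d n < x) = (d n <= t).
  have [dt|td] := leP (d n) t.
    by apply: filterS (nbhs_right_gt t) => x tx; rewrite (le_lt_trans dt tx).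
  apply: filterS (nbhs_right_lt td) => x xt; apply/negbTE.
  by rewrite -leNgt ltW.
near=> x => i; rewrite ltnS leq_eqVlt => /predU1P[->|]; first by near: x.
exact: (near IH).
Unshelve. all: by end_near. Qed.

End order_near.

(** * Step functions with jumps at the impulse points *)

Section step_functions.
Variables (R : realType) (tau : int -> R).
Hypothesis tau_lt : forall i : int, tau i < tau (i + 1).
Variables (K : Type) (idx : K) (op : Monoid.com_law idx).
Variables (n : nat) (k : int -> K).

(** The aggregate of the [k i] over the impulse points [tau i], [1 <= i <= n],
that lie strictly to the left of [t]: a left-continuous step function. *)
Definition step (t : R) : K :=
  \big[op/idx]_(1 <= i < n.+1) (if tau i%:Z < t then k i%:Z else idx).

Lemma step_at_left t : \forall x \near t^'-, step x = step t.
Proof.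
have := near_ltl (fun i => tau i%:Z) n.+1 t; apply: filterS => x H.
by apply: eq_big_nat => i /andP[_ /H ->].
Qed.

Lemma step_near t : ~ range tau t -> \forall x \near t, step x = step t.
Proof.
move=> nt.
have Hr : \forall x \near t^'+, step x = step t.
  have := near_ltr (fun i => tau i%:Z) n.+1 t; apply: filterS => x H.
  apply: eq_big_nat => i /andP[_ /H ->]; rewrite le_eqVlt.
  by have [E|//] := eqVneq (tau i) t; case: nt; exists i%:Z.
have Hl := step_at_left t; rewrite !near_withinE in Hr Hl.
near=> x; have [xt|tx|->//] := ltgtP x t.
  by move: xt; near: x; exact: Hl.
by move: tx; near: x; exact: Hr.
Unshelve. all: by end_near. Qed.

Lemma step_at_right t j : (1 <= j <= n)%N -> t = tau j%:Z ->
  \forall x \near t^'+, step x = op (k j%:Z) (step t).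
Proof.
move=> jn tj; have := near_ltr (fun i => tau i%:Z) n.+1 t; apply: filterS => x H.
have jr : j \in index_iota 1 n.+1 by rewrite mem_index_iota ltnS.
have jx : tau j%:Z < x by rewrite H ?ltnS ?tj ?lexx//; case/andP: jn.
rewrite /step !(bigD1_seq j)//= ?iota_uniq// jx tj ltxx Monoid.mul1m.
congr (op _ _); rewrite big_seq_cond [RHS]big_seq_cond; apply: eq_bigr => i.
rewrite mem_index_iota -andbA => /and3P[_ iln ij]; rewrite H// tj le_eqVlt.
by rewrite (inj_eq (tau_inj tau_lt)) eqz_nat (negbTE ij).
Qed.

Lemma step_low t : t <= tau 1 -> step t = idx.
Proof.
move=> t1; apply: big1_seq => i /andP[_]; rewrite mem_index_iota => /andP[i1 _].
rewrite ltNge (le_trans t1)//.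
by rewrite leNgt (ltr_tau tau_lt) -leNgt lez_nat.
Qed.

Lemma step_high t : tau n%:Z < t ->
  step t = \big[op/idx]_(1 <= i < n.+1) k i%:Z.
Proof.
move=> nt; apply: eq_big_nat => i /andP[_ iln].
rewrite (le_lt_trans _ nt)//.
by rewrite leNgt (ltr_tau tau_lt) -leNgt lez_nat.
Qed.

End step_functions.

(** * Solutions of the impulsive system and uniqueness *)

Section solutions.
Variables (R : realType) (T : R) (r : nat) (tau alpha beta : int -> R).
Variables (a b c : R -> R).
Hypotheses (T_gt0 : 0 < T) (r_gt0 : (0 < r)%N).
Hypothesis tau_lt : forall i : int, tau i < tau (i + 1).
Hypothesis tau_per : forall i : int, tau (i + r%:Z) = tau i + T.
Hypotheses (a_per : periodic_off T tau a) (b_per : periodic_off T tau b).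
Hypothesis c_per : periodic_off T tau c.
Hypothesis alpha_neq0 : forall i : int, alpha i != 0.
Hypothesis alpha_per : forall i : int, alpha (i + r%:Z) = alpha i.
Hypothesis beta_per : forall i : int, beta (i + r%:Z) = beta i.

(** Solutions of the impulsive system, with the one-sided limits at the
impulse points given by witnesses. *)
Definition solution (x u : R -> R) : Prop :=
  (forall t, ~ range tau t ->
     is_derive t 1 x (a t * x t + b t * u t) /\
     is_derive t 1 u (- c t * x t - a t * u t)) /\
  (forall i, exists xl ul : R,
     [/\ x t @[t --> (tau i)^'-] --> xl, u t @[t --> (tau i)^'-] --> ul,
         x t @[t --> (tau i)^'+] --> alpha i * xl &
         u t @[t --> (tau i)^'+] --> alpha i * ul - beta i * xl]).

Lemma hamiltonian_solutionW x u :
  hamiltonian_solution tau alpha beta a b c x u -> solution x u.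
Proof.
move=> [xud xuc xuj]; split=> // i.
have [xl xr ul ur] := xuc i; have [Ex Eu] := xuj i.
by exists (lim (x @ (tau i)^'-)), (lim (u @ (tau i)^'-)); rewrite -Ex -Eu.
Qed.

Lemma solution_lin x u y v p q : solution x u -> solution y v ->
  solution (fun t => p * x t + q * y t) (fun t => p * u t + q * v t).
Proof.
move=> [xd xj] [yd yj]; split.
- move=> t nt; have [dx du] := xd t nt; have [dy dv] := yd t nt; split.
    apply: is_derive_eq (is_derive_add (is_derive_scale p dx)
      (is_derive_scale q dy)) _.
    ring.
  apply: is_derive_eq (is_derive_add (is_derive_scale p du)
      (is_derive_scale q dv)) _.
  ring.
- move=> i; have [xl [ul [xl' ul' xr ur]]] := xj i.
  have [yl [vl [yl' vl' yr vr]]] := yj i.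
  exists (p * xl + q * yl), (p * ul + q * vl).
  have lin (F : set_system R) (f g : R -> R) (l m : R) : Filter F ->
      f t @[t --> F] --> l -> g t @[t --> F] --> m ->
      p * f t + q * g t @[t --> F] --> p * l + q * m.
    by move=> FF fl gm; apply: cvgD; apply: cvgM => //; exact: cvg_cst.
  split; try exact: lin.
  - have -> : alpha i * (p * xl + q * yl) =
      p * (alpha i * xl) + q * (alpha i * yl) by ring.
    exact: lin.
  - have -> : alpha i * (p * ul + q * vl) - beta i * (p * xl + q * yl) =
      p * (alpha i * ul - beta i * xl) + q * (alpha i * vl - beta i * yl) by ring.
    exact: lin.
Qed.

Lemma cvg_left_shift (f : R -> R) (s l : R) :
  f t @[t --> (s + T)^'-] --> l -> f (t + T) @[t --> s^'-] --> l.
Proof.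
apply: cvg_comp => U [e /= e0 H]; exists e => // t /= ste ts.
by apply: H; rewrite /= ?ltrD2r// opprD addrACA subrr addr0.
Qed.

Lemma cvg_right_shift (f : R -> R) (s l : R) :
  f t @[t --> (s + T)^'+] --> l -> f (t + T) @[t --> s^'+] --> l.
Proof.
apply: cvg_comp => U [e /= e0 H]; exists e => // t /= ste ts.
by apply: H; rewrite /= ?ltrD2r// opprD addrACA subrr addr0.
Qed.

Lemma is_derive_shift (f : R -> R) (t s df : R) :
  is_derive (t + s) 1 f df -> is_derive t 1 (fun x => f (x + s)) df.
Proof.
move=> fd.
have d2 : is_derive t 1 (fun x : R => x + s) 1.
  have := is_derive_add (is_derive_id t 1) (is_derive_cst s t 1).
  by rewrite addr0.
by have := @is_derive1_comp R f (fun x => x + s) t _ _ fd d2; rewrite mulr1.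
Qed.

Lemma solution_shift x u : solution x u ->
  solution (fun t => x (t + T)) (fun t => u (t + T)).
Proof.
move=> [xd xj]; split=> [t nt|i].
- have ntT : ~ range tau (t + T) by move/(range_tau_shift tau_per).
  have [dx du] := xd _ ntT; rewrite a_per// b_per// in dx.
  by rewrite a_per// c_per// in du; split; exact: is_derive_shift.
- have [xl [ul]] := xj (i + r%:Z).
  rewrite tau_per alpha_per beta_per => -[? ? ? ?]; exists xl, ul.
  by split; [exact: cvg_left_shift|exact: cvg_left_shift|
    exact: cvg_right_shift|exact: cvg_right_shift].
Qed.

Lemma solution_continuous x u t : solution x u -> ~ range tau t ->
  {for t, continuous x} /\ {for t, continuous u}.
Proof.
by move=> [xd _] /xd [dx du]; split;
  [exact: is_derive_continuous dx|exact: is_derive_continuous du].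
Qed.

(** At every point, on or off the impulse points, a solution has one-sided
limits, which are related by an invertible linear map. *)
Lemma solution_lims x u t : solution x u -> exists xl ul al be : R,
  [/\ al != 0, x z @[z --> t^'-] --> xl, u z @[z --> t^'-] --> ul,
      x z @[z --> t^'+] --> al * xl & u z @[z --> t^'+] --> al * ul - be * xl].
Proof.
move=> xu; have [[i _ <-]|nt] := pselect (range tau t).
  by have [xl [ul [? ? ? ?]]] := xu.2 i; exists xl, ul, (alpha i), (beta i).
have [/continuous_cvg_lr[xl xr] /continuous_cvg_lr[ul ur]] :=
  solution_continuous xu nt.
by exists (x t), (u t), 1, 0; rewrite !mul1r mul0r subr0 oner_neq0.
Qed.

Variable K : R.
Hypothesis abc_le : forall t, ~ range tau t ->
  [/\ `|a t| <= K, `|b t| <= K & `|c t| <= K].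

(* The derivative of the energy [x^2 + u^2] is at most [4 K] times the energy in
   absolute value. *)
Let energy_le t x u : ~ range tau t ->
  `|2 * x * (a t * x + b t * u) + 2 * u * (- c t * x - a t * u)|
    <= 4 * K * (x ^+ 2 + u ^+ 2).
Proof.
move=> /abc_le[aK bK cK].
have K0 : 0 <= K by exact: le_trans aK.
have E : 2 * x * (a t * x + b t * u) + 2 * u * (- c t * x - a t * u) =
  2 * a t * x ^+ 2 + 2 * (b t - c t) * (x * u) - 2 * a t * u ^+ 2 by ring.
have H1 : `|2 * a t * x ^+ 2| <= 2 * K * x ^+ 2.
  rewrite normrM [`|x ^+ 2|]ger0_norm ?sqr_ge0//.
  by rewrite ler_wpM2r ?sqr_ge0// normrM ger0_norm// ler_pM2l.
have H2 : `|2 * a t * u ^+ 2| <= 2 * K * u ^+ 2.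
  rewrite normrM [`|u ^+ 2|]ger0_norm ?sqr_ge0//.
  by rewrite ler_wpM2r ?sqr_ge0// normrM ger0_norm// ler_pM2l.
have H3 : `|2 * (b t - c t) * (x * u)| <= 4 * K * `|x * u|.
  rewrite normrM ler_wpM2r// normrM ger0_norm//.
  have := ler_normB (b t) (c t); lra.
have H4 : 2 * `|x * u| <= x ^+ 2 + u ^+ 2.
  have := sqr_ge0 (`|x| - `|u|); rewrite normrM sqrrB !real_normK ?num_real//; lra.
rewrite E; apply: le_trans (ler_normB _ _) _.
have := ler_normD (2 * a t * x ^+ 2) (2 * (b t - c t) * (x * u)).
have : 2 * K * (2 * `|x * u|) <= 2 * K * (x ^+ 2 + u ^+ 2).
  by rewrite ler_wpM2l// mulr_ge0.
lra.
Qed.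

(* On an interval without impulse, [exp (4Kt) E] is nondecreasing and
   [exp (-4Kt) E] nonincreasing, where [E] is the energy. *)
Let gap_zero x u p q (xp up xq uq : R) : solution x u -> p < q ->
  (forall t, p < t < q -> ~ range tau t) ->
  x t @[t --> p^'+] --> xp -> u t @[t --> p^'+] --> up ->
  x t @[t --> q^'-] --> xq -> u t @[t --> q^'-] --> uq ->
  xp ^+ 2 + up ^+ 2 = 0 <-> xq ^+ 2 + uq ^+ 2 = 0.
Proof.
move=> [xd xj] pq pqr xp' up' xq' uq'.
pose E t := x t ^+ 2 + u t ^+ 2.
pose dE t := 2 * x t * (a t * x t + b t * u t) +
  2 * u t * (- c t * x t - a t * u t).
have dE' t : p < t < q -> is_derive t 1 E (dE t).
  move=> /pqr/xd[dx du].
  have d2 : is_derive t 1 E _ :=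
    is_derive_add (is_derive_mul dx dx) (is_derive_mul du du).
  by apply: is_derive_eq d2 _; rewrite /dE; ring.
have sq (F : set_system R) (f : R -> R) (l : R) : Filter F ->
    f t @[t --> F] --> l -> f t ^+ 2 @[t --> F] --> l ^+ 2.
  by move=> FF fl; apply: cvgM.
have Ep : E t @[t --> p^'+] --> xp ^+ 2 + up ^+ 2 by apply: cvgD; exact: sq.
have Eq : E t @[t --> q^'-] --> xq ^+ 2 + uq ^+ 2 by apply: cvgD; exact: sq.
(* [k = 1] and [k = -1] give the two monotone functions. *)
pose f k t := k * (expR (4 * K * k * t) * E t).
have expc k z : {for z, continuous (fun t : R => expR (4 * K * k * t))}.
  exact: is_derive_continuous
    (is_derive_expR_comp (is_derive_scale (4 * K * k) (is_derive_id z 1))).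
have mono k : `|k| = 1 -> k * (expR (4 * K * k * p) * (xp ^+ 2 + up ^+ 2)) <=
    k * (expR (4 * K * k * q) * (xq ^+ 2 + uq ^+ 2)).
  move=> k1; have kk : k * k = 1.
    by rewrite -expr2 -real_normK ?num_real// k1 expr1n.
  have [_ ep] := continuous_cvg_lr (@expc k p).
  have [eq _] := continuous_cvg_lr (@expc k q).
  apply: (@derive_ge0_le_lim R (f k) (fun t => expR (4 * K * k * t) *
    (4 * K * E t + k * dE t)) p q _ _ pq).
  - move=> t tpq.
    have d1 := is_derive_expR_comp
      (is_derive_scale (4 * K * k) (is_derive_id t 1)).
    apply: is_derive_eq (is_derive_scale k (is_derive_mul d1 (dE' t tpq))) _.
    rewrite /= mulr1.
    have -> : 4 * K * E t = 4 * K * (k * k) * E t by rewrite kk mulr1.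
    ring.
  - move=> t /pqr nt; rewrite mulr_ge0 ?expR_ge0//.
    have := energy_le (x t) (u t) nt; rewrite -/(dE t) -/(E t).
    have : - `|dE t| <= k * dE t.
      by rewrite lerNl -[leRHS]mul1r -k1 -normrM -mulNr -normrN mulNr ler_norm.
    lra.
  - by apply: cvgM; [exact: cvg_cst|apply: cvgM].
  - by apply: cvgM; [exact: cvg_cst|apply: cvgM].
have Ep0 : 0 <= xp ^+ 2 + up ^+ 2 by rewrite addr_ge0 ?sqr_ge0.
have Eq0 : 0 <= xq ^+ 2 + uq ^+ 2 by rewrite addr_ge0 ?sqr_ge0.
split=> E0.
- have := @mono (-1); rewrite normrN normr1 => /(_ erefl).
  rewrite E0 !mulr0 mulN1r oppr_ge0 pmulr_rle0 ?expR_gt0// => Eq1.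
  by apply/eqP; rewrite eq_le Eq1.
- have := @mono 1; rewrite normr1 => /(_ erefl).
  rewrite E0 !mulr0 mul1r pmulr_rle0 ?expR_gt0// => Eq1.
  by apply/eqP; rewrite eq_le Eq1.
Qed.

Let sqr_add_eq0 (x u : R) : x ^+ 2 + u ^+ 2 = 0 <-> x = 0 /\ u = 0.
Proof.
split=> [/eqP|[-> ->]]; last by rewrite expr0n/= addr0.
by rewrite paddr_eq0 ?sqr_ge0// !sqrf_eq0 => /andP[/eqP-> /eqP->].
Qed.

(** A solution that vanishes on one side of an interval vanishes on the other:
the jump conditions are invertible because [alpha i != 0]. *)
Lemma solution_zero_lim x u p q : solution x u -> p < q ->
  forall xp up xq uq : R,
  x t @[t --> p^'+] --> xp -> u t @[t --> p^'+] --> up ->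
  x t @[t --> q^'-] --> xq -> u t @[t --> q^'-] --> uq ->
  (xp = 0 /\ up = 0) <-> (xq = 0 /\ uq = 0).
Proof.
move=> xu pq; have [D HD] := tau_locally_finite T_gt0 r_gt0 tau_lt tau_per p q.
pose Q s t := p <= s -> t <= q -> forall xp up xq uq : R,
  x t @[t --> s^'+] --> xp -> u t @[t --> s^'+] --> up ->
  x t @[t --> t^'-] --> xq -> u t @[t --> t^'-] --> uq ->
  (xp = 0 /\ up = 0) <-> (xq = 0 /\ uq = 0).
suff H : forall s t, s < t -> Q s t by exact: H pq _ _.
refine (@interval_chain R Q D _ _) =>
    [s t st sD ps tq xs us xt ut Hxs Hus Hxt Hut|
     s d t sd dt dD IH1 IH2 ps tq xs us xt ut Hxs Hus Hxt Hut].
- rewrite -!sqr_add_eq0; apply: (gap_zero xu st _ Hxs Hus Hxt Hut).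
  move=> z zst rz; have /HD : p <= z <= q.
    case/andP: zst => sz zt.
    by rewrite !ltW ?(le_lt_trans ps sz) ?(lt_le_trans zt tq).
  by move=> /(_ rz) /sD; rewrite zst.
- have [xl [ul [al [be [al0 xl' ul' xr ur]]]]] := solution_lims d xu.
  have H1 := IH1 ps (ltW (lt_le_trans dt tq)) _ _ _ _ Hxs Hus xl' ul'.
  have H2 := IH2 (ltW (le_lt_trans ps sd)) tq _ _ _ _ xr ur Hxt Hut.
  rewrite H1 -H2; split=> [[-> ->]|[/eqP]]; first by rewrite !mulr0 subr0.
  by rewrite mulf_eq0 (negbTE al0)/= => /eqP->; rewrite mulr0 subr0 => /eqP;
    rewrite mulf_eq0 (negbTE al0)/= => /eqP->.
Qed.

(** Uniqueness for the initial value problem. *)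
Lemma solution_unique x u s t : solution x u -> ~ range tau s ->
  ~ range tau t -> x s = 0 -> u s = 0 -> x t = 0 /\ u t = 0.
Proof.
move=> xu ns nt xs us.
have [/continuous_cvg_lr[xsl xsr] /continuous_cvg_lr[usl usr]] :=
  solution_continuous xu ns.
have [/continuous_cvg_lr[xtl xtr] /continuous_cvg_lr[utl utr]] :=
  solution_continuous xu nt.
have [st|ts|<-//] := ltgtP s t.
  by apply/(solution_zero_lim xu st xsr usr xtl utl).
by apply/(solution_zero_lim xu ts xtr utr xsl usl).
Qed.

End solutions.

(** * Bounded solutions and Floquet solutions *)

Section dichotomy.
Variables (R : realType) (T : R) (r : nat) (tau alpha beta : int -> R).
Variables (a b c : R -> R).
Hypotheses (T_gt0 : 0 < T) (r_gt0 : (0 < r)%N).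
Hypothesis tau_lt : forall i : int, tau i < tau (i + 1).
Hypothesis tau_per : forall i : int, tau (i + r%:Z) = tau i + T.
Hypotheses (tau_first : 0 < tau 1) (tau_last : tau r%:Z < T).
Hypotheses (a_per : periodic_off T tau a) (b_per : periodic_off T tau b).
Hypothesis c_per : periodic_off T tau c.
Hypothesis alpha_neq0 : forall i : int, alpha i != 0.
Hypothesis alpha_per : forall i : int, alpha (i + r%:Z) = alpha i.
Hypothesis beta_per : forall i : int, beta (i + r%:Z) = beta i.

Local Notation sol := (solution tau alpha beta a b c).

Lemma tau_itv (t : R) : 0 <= t <= T -> range tau t ->
  exists2 j : nat, (1 <= j <= r)%N & t = tau j%:Z.
Proof.
move=> /andP[t0 tT] [i _ E].
have i0 : (0 < i).
  rewrite -(ltr_tau tau_lt) E (lt_le_trans _ t0)//.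
  by rewrite -(ltrD2r T) -tau_per !add0r.
have ir : (i < r%:Z + 1).
  rewrite -(ltr_tau tau_lt) E (le_lt_trans tT)//.
  by rewrite addrC tau_per ltrDr.
exists `|i|%N; first by lia.
by rewrite gez0_abs// ltW.
Qed.

Lemma off_range0 : ~ range tau 0.
Proof.
move=> /tau_itv[|j /andP[j1 _] E]; first by rewrite lexx ltW.
have : tau 1 <= tau j%:Z by rewrite leNgt (ltr_tau tau_lt) -leNgt lez_nat.
by rewrite -E leNgt tau_first.
Qed.

Lemma off_rangeT : ~ range tau T.
Proof. by rewrite -[T]add0r => /(range_tau_shift tau_per)/off_range0. Qed.

Lemma periodic_off_addn (f : R -> R) t n : periodic_off T tau f ->
  ~ range tau t -> f (t + T *+ n) = f t /\ ~ range tau (t + T *+ n).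
Proof.
move=> fp; elim: n => [|n IH] nt; first by rewrite mulr0n addr0.
have [E nn] := IH nt; rewrite mulrSr addrA fp//; split=> //.
by move/(range_tau_shift tau_per).
Qed.

(** Every point off the impulse points has a representative in [[0, T]] at
which all periodic functions take the same value. *)
Lemma periodic_off_base t : ~ range tau t -> exists2 s,
  0 <= s <= T /\ ~ range tau s &
  forall f : R -> R, periodic_off T tau f -> f t = f s.
Proof.
move=> nt; pose s := t - (Num.floor (t / T))%:~R * T.
have sT : 0 <= s <= T.
  have := Num.Theory.floor_itv (t / T); rewrite ler_pdivlMr// ltr_pdivrMr//.
  rewrite /s subr_ge0 lerBlDr intrD mulrDl mul1r => /andP[-> /ltW].
  by rewrite addrC => ->.
have [n [E|E]] : exists n : nat, t = s + T *+ n \/ s = t + T *+ n.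
  rewrite /s; case: (Num.floor _) => n.
  - by exists n; left; rewrite -pmulrn mulr_natl subrK.
  - by exists n.+1; right; rewrite NegzE mulrNz mulNr opprK -pmulrn mulr_natl.
- have ns : ~ range tau s.
    move=> rs; apply: nt; rewrite E.
    elim: (n) => [|m IH]; rewrite ?mulr0n ?addr0// mulrSr addrA.
    exact/(range_tau_shift tau_per).
  exists s => // f fp; rewrite {1}E.
  by have [-> _] := periodic_off_addn n fp ns.
- exists s => [|f fp].
    by split=> //; rewrite E; have [] := @periodic_off_addn (fun=> 0) t n _ nt.
  by rewrite E; have [-> _] := periodic_off_addn n fp nt.
Qed.

Lemma solution_bounded2 x u : sol x u ->
  exists M, forall t, 0 <= t <= T + T -> `|x t| <= M /\ `|u t| <= M.
Proof.
move=> xu; have TT0 : 0 < T + T by rewrite addr_gt0.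
have [D HD] := tau_locally_finite T_gt0 r_gt0 tau_lt tau_per 0 (T + T).
have offD t : 0 < t < T + T -> t \notin D -> ~ range tau t.
  move=> /andP[t0 tT] tD rt; have := HD t; rewrite !ltW// => /(_ isT rt).
  by rewrite (negbTE tD).
have lims t := solution_lims alpha_neq0 t xu.
have [|t _|t _|M1 H1] := @bounded_piecewise R (T + T) D x TT0.
- by move=> t tT tD; case: (solution_continuous xu (offD t tT tD)).
- have [xl [ul [al [be [_ _ _ xr _]]]]] := lims t; exact: cvgP xr.
- have [xl [ul [al [be [_ xl' _ _ _]]]]] := lims t; exact: cvgP xl'.
have [|t _|t _|M2 H2] := @bounded_piecewise R (T + T) D u TT0.
- by move=> t tT tD; case: (solution_continuous xu (offD t tT tD)).
- have [xl [ul [al [be [_ _ _ _ ur]]]]] := lims t; exact: cvgP ur.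
- have [xl [ul [al [be [_ _ ul' _ _]]]]] := lims t; exact: cvgP ul'.
exists (Num.max M1 M2) => t tT; rewrite !le_max H1// H2//.
by rewrite orbT.
Qed.

Hypothesis prod_alpha : \prod_(1 <= i < r.+1) alpha i%:Z ^+ 2 = 1.

(** The Wronskian divided by the product of [alpha i ^+ 2] over the impulses
already met is constant on [[0, T]]. *)
Lemma wronskian_period x u y v : sol x u -> sol y v ->
  x T * v T - y T * u T = x 0 * v 0 - y 0 * u 0.
Proof.
move=> xu yv.
pose al2 (i : int) := alpha i ^+ 2.
pose g := step tau *%R r al2.
pose W t := (x t * v t - y t * u t).
pose V t := W t / g t.
have g_neq0 t : g t != 0.
  rewrite /g /step; apply: (big_ind (fun z : R => z != 0)) => [|p q p0 q0|i _].
  - exact: oner_neq0.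
  - by rewrite mulf_neq0.
  - by case: ifP; rewrite ?oner_neq0// expf_neq0.
have [D HD] := tau_locally_finite T_gt0 r_gt0 tau_lt tau_per 0 T.
have W_cvg (F : set_system R) (FF : Filter F) (x1 u1 y1 v1 : R) :
    x t @[t --> F] --> x1 -> u t @[t --> F] --> u1 ->
    y t @[t --> F] --> y1 -> v t @[t --> F] --> v1 ->
    W t @[t --> F] --> x1 * v1 - y1 * u1.
  by move=> ? ? ? ?; apply: cvgB; apply: cvgM.
have V_cvg (F : set_system R) (FF : Filter F) (l m : R) :
    (\forall t \near F, g t = m) -> W t @[t --> F] --> l ->
    V t @[t --> F] --> l / m.
  move=> gm Wl; apply: (@cvg_trans _ ((fun t => W t / m) @ F)).
    by apply: near_eq_cvg; apply: filterS gm => t; rewrite /V => ->.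
  by apply: cvgM => //; exact: cvg_cst.
have Vd t : ~ range tau t -> is_derive t 1 V 0.
  move=> nt; have [dx du] := xu.1 t nt; have [dy dv] := yv.1 t nt.
  have dW : is_derive t 1 W _ := is_derive_add (is_derive_mul dx dv)
    (is_derive_opp (is_derive_mul dy du)).
  have dWm : is_derive t 1 (fun s => (g t)^-1 * W s) 0.
    by apply: is_derive_eq (is_derive_scale (g t)^-1 dW) _; ring.
  apply: near_eq_is_derive dWm.
  have := @step_near R tau _ _ *%R r al2 t nt.
  by apply: filterS => s; rewrite /V mulrC /g => ->.
have Vj t : 0 < t < T -> exists l : R,
    V s @[s --> t^'-] --> l /\ V s @[s --> t^'+] --> l.
  move=> /andP[t0 tT]; have [rt|nt] := pselect (range tau t); last first.
    have [? ?] := continuous_cvg_lr (is_derive_continuous (Vd t nt)).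
    by exists (V t).
  have [|j jr tj] := tau_itv _ rt; first by rewrite !ltW.
  have [xl [ul [xl' ul' xr ur]]] := xu.2 j%:Z.
  have [yl [vl [yl' vl' yr vr]]] := yv.2 j%:Z.
  rewrite -tj in xl' ul' xr ur yl' vl' yr vr.
  have gl := step_at_left tau *%R r al2 t.
  have gr := @step_at_right R tau tau_lt _ _ *%R r al2 t j jr tj.
  exists ((xl * vl - yl * ul) / g t); split.
    by apply: V_cvg => //; exact: W_cvg.
  have a0 := alpha_neq0 j%:Z; have gt0 := g_neq0 t.
  have <- : (alpha j%:Z * xl * (alpha j%:Z * vl - beta j%:Z * yl) -
      alpha j%:Z * yl * (alpha j%:Z * ul - beta j%:Z * xl)) /
    (al2 j%:Z * g t) = (xl * vl - yl * ul) / g t.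
    by rewrite /al2; field; rewrite a0 gt0.
  by apply: V_cvg; [exact: gr|exact: W_cvg].
have [_ V0] := continuous_cvg_lr (is_derive_continuous (Vd 0 off_range0)).
have [VT _] := continuous_cvg_lr (is_derive_continuous (Vd T off_rangeT)).
have offD t : 0 < t < T -> t \notin D -> ~ range tau t.
  move=> /andP[t0 tT] tD rt; have := HD t; rewrite !ltW// => /(_ isT rt).
  by rewrite (negbTE tD).
have VTE : V T = V 0.
  apply/eqP; rewrite eq_le; apply/andP; split; last first.
    apply: (@le_lim_jump R V (fun=> 0) D 0 T) => //.
    - by move=> t tT tD; apply: Vd; exact: offD.
    - by move=> t tT _; have [l [? ?]] := Vj t tT; exists l, l.
  rewrite -lerN2.
  apply: (@le_lim_jump R (fun t => - V t) (fun=> - 0) D 0 T) => //.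
  - by move=> t tT tD; apply: is_derive_opp; apply: Vd; exact: offD.
  - move=> t tT _; have [l [? ?]] := Vj t tT; exists (- l), (- l).
    by split=> //; exact: cvgN.
  - exact: cvgN.
  - exact: cvgN.
move: VTE; rewrite /V /g (step_high tau_lt)// (step_low tau_lt) ?ltW//.
by rewrite /al2 prod_alpha !divr1.
Qed.

Variable K : R.
Hypothesis abc_le : forall t, ~ range tau t ->
  [/\ `|a t| <= K, `|b t| <= K & `|c t| <= K].

Let unique x u s t : sol x u -> ~ range tau s -> ~ range tau t ->
  x s = 0 -> u s = 0 -> x t = 0 /\ u t = 0.
Proof.
by move=> xu ns nt; apply: (@solution_unique R T r tau alpha beta a b c); eauto.
Qed.

Let shift x u := @solution_shift R T r tau alpha beta a b c tau_per a_per b_per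
  c_per alpha_per beta_per x u.

(** [(x, u)] is a Floquet solution with real multiplier [rho]. *)
Definition floquet_solution (rho : R) (x u : R -> R) : Prop :=
  sol x u /\ forall t, ~ range tau t ->
    x (t + T) = rho * x t /\ u (t + T) = rho * u t.

(** The quadratic form [Q] below is periodic along the recurrence, and bounded
below by [(1 - `|p| / 2) X^2]. *)
Lemma recurrence_bounded (p M : R) (X : R -> R) : `|p| < 2 ->
  (forall t, ~ range tau t -> X (t + T + T) = p * X (t + T) - X t) ->
  (forall t, 0 <= t <= T + T -> `|X t| <= M) ->
  forall t, ~ range tau t -> X t ^+ 2 <= 4 * M ^+ 2 / (1 - `|p| / 2).
Proof.
move=> p2 Xrec XM t nt.
pose Q t := X (t + T) ^+ 2 - p * X (t + T) * X t + X t ^+ 2.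
have Q_per : periodic_off T tau Q by move=> s ns; rewrite /Q Xrec//; ring.
have [s [/andP[s0 sT] ns] /(_ Q Q_per) Qts] := periodic_off_base nt.
have M0 : 0 <= M by apply: le_trans (XM 0 _); rewrite // lexx addr_ge0 ?ltW.
have pxy z w : `|p * z * w| <= `|p| * ((z ^+ 2 + w ^+ 2) / 2).
  rewrite -mulrA normrM ler_wpM2l// ler_pdivlMr//.
  have := sqr_ge0 (`|z| - `|w|); rewrite normrM sqrrB !real_normK ?num_real//; lra.
have sqM z : 0 <= z <= T + T -> X z ^+ 2 <= M ^+ 2.
  by move=> /XM; rewrite -[X z ^+ 2]real_normK ?num_real// ler_sqr ?nnegrE.
have QM : Q s <= 4 * M ^+ 2.
  have H1 : X s ^+ 2 <= M ^+ 2.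
    by apply: sqM; rewrite s0 (le_trans sT)// lerDl ltW.
  have H2 : X (s + T) ^+ 2 <= M ^+ 2.
    by apply: sqM; rewrite lerD2r sT andbT addr_ge0// ltW.
  have := pxy (X (s + T)) (X s); have := ler_norm (- (p * X (s + T) * X s)).
  rewrite normrN /Q => H3 H4.
  have : `|p| * ((X (s + T) ^+ 2 + X s ^+ 2) / 2) <=
      2 * ((X (s + T) ^+ 2 + X s ^+ 2) / 2).
    apply: ler_wpM2r; last exact: ltW.
    by rewrite divr_ge0// addr_ge0// sqr_ge0.
  lra.
have QX : (1 - `|p| / 2) * X t ^+ 2 <= Q t.
  have := pxy (X (t + T)) (X t); have := ler_norm (p * X (t + T) * X t).
  have : 0 <= (2 - `|p|) * X (t + T) ^+ 2.
    by rewrite mulr_ge0 ?sqr_ge0// subr_ge0 ltW.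
  rewrite /Q; lra.
rewrite ler_pdivlMr; last by rewrite subr_gt0 ltr_pdivrMr// mul1r.
by rewrite mulrC (le_trans QX)// Qts.
Qed.

Lemma le_sqr_bound (z B : R) : z ^+ 2 <= B -> `|z| <= 1 + B.
Proof.
move=> zB; have := sqr_ge0 (`|z| - 1); rewrite sqrrB real_normK ?num_real// expr1n.
have := normr_ge0 z; lra.
Qed.

(** A solution is bounded, unless the system has a nowhere vanishing solution
with a nonzero real multiplier. *)
Lemma bounded_or_floquet x u : sol x u ->
  (exists M, forall t, ~ range tau t -> `|x t| <= M /\ `|u t| <= M) \/
  (exists rho y v, [/\ rho != 0, floquet_solution rho y v &
     forall t, ~ range tau t -> ~ (y t = 0 /\ v t = 0)]).
Proof.
move=> xu.
have nonzero y v : sol y v -> ~ (y 0 = 0 /\ v 0 = 0) ->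
    forall t, ~ range tau t -> ~ (y t = 0 /\ v t = 0).
  move=> yv n0 t nt [yt vt]; apply: n0.
  exact: (unique yv nt off_range0).
have xu1 := shift xu; have xu2 := shift xu1.
have wr := wronskian_period xu xu1.
rewrite /= !add0r in wr.
have [x0|n0] := pselect (x 0 = 0 /\ u 0 = 0).
  left; exists 0 => t nt; have [-> ->] := unique xu off_range0 nt x0.1 x0.2.
  by rewrite normr0.
have [W0|W0] := eqVneq (x 0 * u T - x T * u 0) 0.
  right.
  have [rho [xT uT]] : exists rho, x T = rho * x 0 /\ u T = rho * u 0.
    have [x00|x00] := eqVneq (x 0) 0.
      have u00 : u 0 != 0 by apply/eqP => u00; apply: n0.
      exists (u T / u 0); rewrite x00 mulr0 divfK//; split=> //.
      move: W0; rewrite x00 mul0r sub0r => /eqP.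
      by rewrite oppr_eq0 mulf_eq0 (negbTE u00) orbF => /eqP.
    exists (x T / x 0); rewrite divfK//; split=> //.
    apply: (mulfI x00); rewrite mulrCA mulrA divfK//.
    by apply/eqP; rewrite -subr_eq0 W0.
  have H := solution_lin 1 (- rho) xu1 xu.
  exists rho, x, u; split.
  - apply/eqP => rho0; apply: n0.
    by apply: (unique xu off_rangeT off_range0); rewrite ?xT ?uT rho0 mul0r.
  - split=> // t nt.
    have [||E1 E2] := unique H off_range0 nt.
    + by rewrite add0r xT; ring.
    + by rewrite add0r uT; ring.
    + by split; apply/eqP; rewrite -subr_eq0 -mulNr -[X in X + _]mul1r ?E1 ?E2.
  - exact: nonzero xu n0.
pose W := x 0 * u T - x T * u 0.
(* Cramer's rule expresses [z(2T)] by [z(T)] and [z(0)]; the coefficient of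
   [z(0)] is [-1] because the Wronskian takes equal values at [0] and [T]. *)
pose p := (x 0 * u (T + T) - x (T + T) * u 0) / W.
have H := solution_lin 1 1 (solution_lin 1 (- p) xu2 xu1) xu.
have rec t : ~ range tau t ->
    x (t + T + T) = p * x (t + T) - x t /\ u (t + T + T) = p * u (t + T) - u t.
  move=> nt; have [||E1 E2] := unique H off_range0 nt.
  - rewrite /= !add0r !mul1r; apply: (mulfI W0); rewrite mulr0.
    rewrite !mulrDr mulNr mulrN -/W (mulrA W p) [W * p]mulrC /p divfK//.
    rewrite -[X in _ + X]mulrC.
    have -> : x 0 * W = x 0 * (x T * u (T + T) - x (T + T) * u T) by rewrite wr.
    by rewrite /W; ring.
  - rewrite /= !add0r !mul1r; apply: (mulfI W0); rewrite mulr0.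
    rewrite !mulrDr mulNr mulrN -/W (mulrA W p) [W * p]mulrC /p divfK//.
    rewrite -[X in _ + X]mulrC.
    have -> : u 0 * W = u 0 * (x T * u (T + T) - x (T + T) * u T) by rewrite wr.
    by rewrite /W; ring.
  - by split; apply/eqP; rewrite -subr_eq0; apply/eqP; [rewrite -E1|rewrite -E2]; ring.
have [p2|p2] := ltP `|p| 2.
  left; have [M HM] := solution_bounded2 xu.
  pose B := 4 * M ^+ 2 / (1 - `|p| / 2).
  exists (1 + B) => t nt; split; apply: le_sqr_bound.
    by apply: recurrence_bounded => // [s /rec[]|s /HM[]].
  by apply: recurrence_bounded => // [s /rec[]|s /HM[]].
right.
pose d := Num.sqrt (p ^+ 2 - 4).
have dd : d * d = p ^+ 2 - 4.
  rewrite -expr2 sqr_sqrtr// subr_ge0 -[p ^+ 2]real_normK ?num_real//.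
  by rewrite (_ : 4 = 2 ^+ 2) ?ler_sqr ?nnegrE//; ring.
(* The roots of [X^2 - p X + 1]. *)
pose l := (p + d) / 2; pose m := (p - d) / 2.
have lm : l * m = 1.
  have -> : l * m = (p ^+ 2 - d * d) / 4 by rewrite /l /m; field.
  by rewrite dd; field.
have lpm : l + m = p by rewrite /l /m; field.
have yv := solution_lin 1 (- m) xu1 xu.
exists l, (fun t => 1 * x (t + T) + - m * x t),
  (fun t => 1 * u (t + T) + - m * u t).
split.
- by apply: contra_eq_neq lm => ->; rewrite mul0r eq_sym oner_neq0.
- split=> // t nt; have [-> ->] := rec t nt.
  have key z w : 1 * (p * w - z) + - m * w = l * (1 * w + - m * z).
    have -> : l * (1 * w + - m * z) = l * w - l * m * z by ring.
    by rewrite lm -lpm; ring.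
  by split; exact: key.
- apply: nonzero => //; rewrite !add0r => -[E1 E2].
  move/eqP: W0; apply.
  have -> : x T = m * x 0 by lra.
  have -> : u T = m * u 0 by lra.
  ring.
Qed.

End dichotomy.

(** * Integrability of the coefficients *)

Section piecewise_data.
Variables (R : realType) (T : R) (r : nat) (tau : int -> R).
Hypotheses (T_gt0 : 0 < T) (r_gt0 : (0 < r)%N).
Hypothesis tau_lt : forall i : int, tau i < tau (i + 1).
Hypothesis tau_per : forall i : int, tau (i + r%:Z) = tau i + T.
Hypotheses (tau_first : 0 < tau 1) (tau_last : tau r%:Z < T).
Notation mu := (@lebesgue_measure R).

Let A := `[0, T] `\` [set tau i%:Z | i in [set i | (1 <= i <= r)%N]].

Let offA (t : R) : 0 <= t <= T -> ~ range tau t -> A t.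
Proof.
move=> tT nt; split; rewrite /= ?in_itv//.
by move=> [i _ E]; apply: nt; exists i%:Z.
Qed.

Lemma in_PC_continuous (f : R -> R) (t : R) :
  in_PC T r tau f -> 0 < t < T -> ~ range tau t ->
  {for t, continuous f}.
Proof.
move=> [/subspace_continuousP fc _] tT nt.
have At : A t by apply: offA => //; case/andP: tT => *; rewrite !ltW.
have := fc t At; rewrite within_interior//.
suff : \forall x \near t, A x by [].
have := near_off_range T_gt0 r_gt0 tau_lt tau_per nt.
case/andP: tT => t0 tT.
move=> nx; near=> x; apply: offA; last exact: (near nx).
by apply/andP; split; apply: ltW; near: x; [exact: lt_nbhsr|exact: lt_nbhsl].
Unshelve. all: by end_near. Qed.

Lemma in_PC_cvg_right (f : R -> R) (t : R) : in_PC T r tau f -> 0 <= t < T ->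
  cvg (f x @[x --> t^'+]).
Proof.
move=> [/subspace_continuousP fc fj] /andP[t0 tT].
have [rt|nt] := pselect (range tau t).
  have [|j jr ->] := tau_itv T_gt0 r_gt0 tau_lt tau_per tau_first
    tau_last _ rt; first by rewrite t0 ltW.
  by case: (fj j jr).
have At : A t by apply: offA => //; rewrite t0 ltW.
apply: (@cvgP _ _ (f t)); apply: cvg_trans (fc t At).
apply: cvg_app => U HU.
have {}HU : \forall x \near t, A x -> U x by exact: HU.
suff : \forall x \near t, t < x -> U x by [].
have := near_off_tau T_gt0 r_gt0 tau_lt tau_per t => nx.
near=> x => tx; apply: (near HU x) => //; apply: offA; last first.
  by apply: (near nx) => //; rewrite gt_eqF.
by rewrite (le_trans t0 (ltW tx)) ltW//; near: x; exact: lt_nbhsl.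
Unshelve. all: by end_near. Qed.

Lemma in_PC_cvg_left (f : R -> R) (t : R) : in_PC T r tau f -> 0 < t <= T ->
  cvg (f x @[x --> t^'-]).
Proof.
move=> [/subspace_continuousP fc fj] /andP[t0 tT].
have [rt|nt] := pselect (range tau t).
  have [|j jr ->] := tau_itv T_gt0 r_gt0 tau_lt tau_per tau_first
    tau_last _ rt; first by rewrite tT ltW.
  by case: (fj j jr).
have At : A t by apply: offA => //; rewrite tT ltW.
apply: (@cvgP _ _ (f t)); apply: cvg_trans (fc t At).
apply: cvg_app => U HU.
have {}HU : \forall x \near t, A x -> U x by exact: HU.
suff : \forall x \near t, x < t -> U x by [].
have := near_off_tau T_gt0 r_gt0 tau_lt tau_per t => nx.
near=> x => tx; apply: (near HU x) => //; apply: offA; last first.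
  by apply: (near nx) => //; rewrite lt_eqF.
by rewrite (le_trans (ltW tx) tT) ltW//; near: x; exact: lt_nbhsr.
Unshelve. all: by end_near. Qed.

Let off_seq : exists D : seq R, forall t, 0 <= t <= T -> t \notin D ->
  ~ range tau t.
Proof.
have [D HD] := tau_locally_finite T_gt0 r_gt0 tau_lt tau_per 0 T.
by exists D => t tT tD rt; rewrite HD in tD.
Qed.

Lemma in_PC_bounded (f : R -> R) : in_PC T r tau f ->
  exists M, forall t, 0 <= t <= T -> `|f t| <= M.
Proof.
move=> fPC; have [D HD] := off_seq.
apply: (@bounded_piecewise R T D f T_gt0).
- move=> t tT tD; apply: in_PC_continuous => //; apply: HD => //.
  by case/andP: tT => *; rewrite !ltW.
- by move=> t; exact: in_PC_cvg_right.
- by move=> t; exact: in_PC_cvg_left.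
Qed.

Lemma measurable_off_tau (f : R -> R) :
  (forall t, 0 < t < T -> ~ range tau t -> {for t, continuous f}) ->
  measurable_fun `[0, T] f.
Proof.
move=> fc; have [D HD] := off_seq.
apply: (@measurable_fun_piecewise R T D f) => t tT tD; apply: fc => //.
by apply: HD => //; case/andP: tT => *; rewrite !ltW.
Qed.

Lemma integrable_off_tau (f : R -> R) (M : R) :
  (forall t, 0 < t < T -> ~ range tau t -> {for t, continuous f}) ->
  (forall t, 0 <= t <= T -> `|f t| <= M) ->
  mu.-integrable `[0, T] (EFin \o f).
Proof.
by move=> fc fM; apply: integrable_bounded fM; exact: measurable_off_tau.
Qed.

(** A function bounded above is integrable as soon as its integral, as an
extended real, is not [-oo]. This applies to [c - a^2 / b], where [b] may tend
to [0] at an impulse point. *)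
Lemma integrable_of_upper_bound (g : R -> R) (M s : R) :
  (forall t, 0 < t < T -> ~ range tau t -> {for t, continuous g}) ->
  (forall t, 0 <= t <= T -> ~ range tau t -> g t <= M) ->
  (0 < \int[mu]_(t in `[0%R, T]) (g t)%:E + s%:E)%E ->
  mu.-integrable `[0, T] (EFin \o g).
Proof.
move=> gc gM pos.
have mg := (measurable_realfun.measurable_EFinP _ _).2 (measurable_off_tau gc).
have [D HD] := off_seq.
pose N := \big[Num.max/Num.max M 0]_(d <- D) g d.
have N0 : 0 <= N.
  by apply: le_trans (bigmax_ge_id _ _ _ _); rewrite le_max lexx orbT.
have gN t : 0 <= t <= T -> g t <= N.
  move=> tT; have [tD|tD] := boolP (t \in D).
    exact: (le_bigmax_seq _ _ xpredT g).
  apply: le_trans (bigmax_ge_id _ _ _ _); rewrite le_max gM//.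
  exact: HD.
have T_fin : (mu `[0%R, T] < +oo)%E.
  by rewrite /= lebesgue_measure_itv/=; case: ifP => _; rewrite ltry.
have ip : mu.-integrable `[0, T] ((EFin \o g)^\+)%E.
  have -> : ((EFin \o g)^\+)%E = EFin \o (fun t => Num.max (g t) 0).
    by apply/funext => t; rewrite funeposE /= -EFin_max.
  apply: measurable_bounded_integrable => //.
    by apply: measurable_realfun.measurable_maxr => //; exact: measurable_off_tau.
  exists N; split; first exact: num_real.
  move=> x Nx t; rewrite /= in_itv/= => tT.
  rewrite ger0_norm ?le_max ?lexx ?orbT// (le_trans _ (ltW Nx))//.
  by rewrite ge_max gN.
have im : mu.-integrable `[0, T] ((EFin \o g)^\-)%E.
  apply/integrableP; split; first exact: measurable_realfun.measurable_funeneg.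
  under eq_integral do rewrite gee0_abs ?funeneg_ge0//.
  rewrite ltey; apply/negP => /eqP infty; move: pos.
  by rewrite integralE infty addeNy addNye.
have -> : EFin \o g = (fun t => (EFin \o g)^\+%E t - (EFin \o g)^\-%E t)%E.
  by rewrite [LHS]funeposneg.
exact: integrableB.
Qed.

End piecewise_data.

(** * Floquet solutions without zeros: the Riccati substitution *)

Section riccati.
Variables (R : realType) (T : R) (r : nat) (tau alpha beta : int -> R).
Variables (a b c : R -> R).
Hypotheses (T_gt0 : 0 < T) (r_gt0 : (0 < r)%N).
Hypothesis tau_lt : forall i : int, tau i < tau (i + 1).
Hypothesis tau_per : forall i : int, tau (i + r%:Z) = tau i + T.
Hypotheses (tau_first : 0 < tau 1) (tau_last : tau r%:Z < T).
Hypothesis alpha_neq0 : forall i : int, alpha i != 0.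
Hypothesis b_gt0 : forall t, ~ range tau t -> 0 < b t.
Notation mu := (@lebesgue_measure R).
Let g t := c t - a t ^+ 2 / b t.
Hypothesis g_int : mu.-integrable `[0, T] (EFin \o g).
Hypothesis g_cont : forall t, 0 < t < T -> ~ range tau t ->
  {for t, continuous g}.

(** The no-zero condition is on the left limits of [x], so that it also covers
the impulse points. *)
Lemma riccati_le0 rho x u :
  floquet_solution T tau alpha beta a b c rho x u -> rho != 0 ->
  (forall t l : R, 0 <= t <= T -> x s @[s --> t^'-] --> l -> l != 0) ->
  \int[mu]_(t in `[0, T]) g t
    + \sum_(1 <= i < r.+1) beta i%:Z / alpha i%:Z <= 0.
Proof.
move=> [xu xu_rho] rho0 x_neq0.
have off0 := off_range0 T_gt0 r_gt0 tau_lt tau_per tau_first tau_last.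
have offT := off_rangeT T_gt0 r_gt0 tau_lt tau_per tau_first tau_last.
pose be (i : int) := beta i / alpha i.
pose S := step tau +%R r be.
pose G := prim T g.
have Gc : continuous G by exact: prim_continuous.
(* [h] is continuous across the impulses and nonincreasing. *)
pose h t := u t / x t + (G t + S t).
have xt0 t : 0 <= t <= T -> ~ range tau t -> x t != 0.
  move=> tT nt; apply: (x_neq0 t) => //.
  by have [/continuous_cvg_lr[]] := solution_continuous xu nt.
pose dh t := ((- c t * x t - a t * u t) * x t - u t * (a t * x t + b t * u t))
  / x t ^+ 2 + (g t + 0).
have Sd t : ~ range tau t -> is_derive t 1 S 0.
  move=> nt; apply: near_eq_is_derive (is_derive_cst (S t) t 1).
  have := @step_near R tau _ _ +%R r be t nt.
  by apply: filterS => s E; rewrite /S /= E.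
have hd t : 0 < t < T -> ~ range tau t -> is_derive t 1 h (dh t).
  move=> tT nt; have tT' : 0 <= t <= T by case/andP: tT => *; rewrite !ltW.
  have [dx du] := xu.1 t nt.
  have dG : is_derive t 1 G (g t) by apply: is_derive_prim => //; exact: g_cont.
  exact: is_derive_add (is_derive_div (xt0 t tT' nt) du dx)
    (is_derive_add dG (Sd t nt)).
have dh_le0 t : 0 < t < T -> ~ range tau t -> 0 <= - dh t.
  move=> tT nt; have tT' : 0 <= t <= T by case/andP: tT => *; rewrite !ltW.
  have x0 := xt0 t tT' nt; have b0 := b_gt0 nt.
  have -> : - dh t = (b t * u t + a t * x t) ^+ 2 / (b t * x t ^+ 2).
    by rewrite /dh /g; field; rewrite x0 gt_eqF.
  by rewrite divr_ge0 ?sqr_ge0// mulr_ge0 ?sqr_ge0// ltW.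
have [D HD] := tau_locally_finite T_gt0 r_gt0 tau_lt tau_per 0 T.
have offD t : 0 < t < T -> t \notin D -> ~ range tau t.
  move=> /andP[t0 tT] tD rt; have := HD t; rewrite !ltW// => /(_ isT rt).
  by rewrite (negbTE tD).
have Gl t := continuous_cvg_lr (Gc t).
have h_left (t ul xl : R) : xl != 0 -> u s @[s --> t^'-] --> ul ->
    x s @[s --> t^'-] --> xl ->
    h s @[s --> t^'-] --> ul / xl + (G t + S t).
  move=> xl0 ul' xl'; apply: cvgD.
    by apply: cvgM => //; exact: cvgV.
  apply: cvgD; first exact: (Gl t).1.
  by apply: cvg_near_cst; exact: (step_at_left tau +%R r be t).
have h_right (t ur xr m : R) : xr != 0 -> u s @[s --> t^'+] --> ur ->
    x s @[s --> t^'+] --> xr -> (\forall s \near t^'+, S s = m) ->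
    h s @[s --> t^'+] --> ur / xr + (G t + m).
  move=> xl0 ul' xl' Sm; apply: cvgD.
    by apply: cvgM => //; exact: cvgV.
  apply: cvgD; first exact: (Gl t).2.
  exact: cvg_near_cst.
have S_right t : ~ range tau t -> \forall s \near t^'+, S s = S t.
  by move=> nt; exact: cvg_within (@step_near R tau _ _ +%R r be t nt).
have [/continuous_cvg_lr[xl0 xr0] /continuous_cvg_lr[ul0 ur0]] :=
  solution_continuous xu off0.
have [/continuous_cvg_lr[xlT xrT] /continuous_cvg_lr[ulT urT]] :=
  solution_continuous xu offT.
have x00 : x 0 != 0 by apply: xt0 => //; rewrite lexx ltW.
have xT0 : x T != 0 by apply: xt0 => //; rewrite lexx ltW.
have H0 := h_right 0 _ _ _ x00 ur0 xr0 (S_right 0 off0).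
have HT := h_left T _ _ xT0 ulT xlT.
have : - (u 0 / x 0 + (G 0 + S 0)) <= - (u T / x T + (G T + S T)).
  apply: (@le_lim_jump R (fun t => - h t) (fun t => - dh t) D 0 T) => //.
  - by move=> t tT tD; apply: is_derive_opp; apply: hd => //; exact: offD.
  - by move=> t tT tD; apply: dh_le0 => //; exact: offD.
  - move=> t tT _; have tT' : 0 <= t <= T by case/andP: tT => *; rewrite !ltW.
    have [rt|nt] := pselect (range tau t).
      have [j jr tj] := tau_itv T_gt0 r_gt0 tau_lt tau_per tau_first
        tau_last tT' rt.
      have [xl [ul [xl' ul' xr ur]]] := xu.2 j%:Z.
      rewrite -tj in xl' ul' xr ur.
      have xl_neq0 := x_neq0 t xl tT' xl'.
      have al0 := alpha_neq0 j%:Z.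
      have Hl := h_left t _ _ xl_neq0 ul' xl'.
      have Hr := h_right t _ _ _ (mulf_neq0 al0 xl_neq0) ur xr
        (@step_at_right R tau tau_lt _ _ +%R r be t j jr tj).
      exists (- (ul / xl + (G t + S t))), (- (ul / xl + (G t + S t))); split=> //.
        exact: cvgN.
      have <- : (alpha j * ul - beta j * xl) / (alpha j * xl) +
          (G t + (be j + S t)) = ul / xl + (G t + S t).
        by rewrite /be; field; rewrite xl_neq0 al0.
      exact: cvgN.
    have [hl hr] := continuous_cvg_lr (is_derive_continuous (hd t tT nt)).
    by exists (- h t), (- h t); split=> //; exact: cvgN.
  - exact: cvgN.
  - exact: cvgN.
have [] := xu_rho 0 off0; rewrite add0r => -> ->.
rewrite -mulf_div divff// mul1r.
rewrite /G (prim_le0 T_gt0)// (prim_geT T_gt0)// /S.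
rewrite (step_low tau_lt _ _ _ (ltW tau_first)) (step_high tau_lt)//.
rewrite /be; lra.
Qed.

End riccati.

(** * Floquet solutions with a zero: the Lyapunov inequality *)

Section lyapunov_obstruction.
Variables (R : realType) (T : R) (r : nat) (tau alpha beta : int -> R).
Variables (a b c : R -> R).
Hypotheses (T_gt0 : 0 < T) (r_gt0 : (0 < r)%N).
Hypothesis tau_lt : forall i : int, tau i < tau (i + 1).
Hypothesis tau_per : forall i : int, tau (i + r%:Z) = tau i + T.
Hypotheses (tau_first : 0 < tau 1) (tau_last : tau r%:Z < T).
Hypotheses (a_per : periodic_off T tau a) (b_per : periodic_off T tau b).
Hypothesis c_per : periodic_off T tau c.
Hypothesis alpha_neq0 : forall i : int, alpha i != 0.
Hypothesis alpha_per : forall i : int, alpha (i + r%:Z) = alpha i.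
Hypothesis beta_per : forall i : int, beta (i + r%:Z) = beta i.
Hypothesis b_gt0 : forall t, ~ range tau t -> 0 < b t.
Notation mu := (@lebesgue_measure R).
Let cp t := Num.max (c t) 0.
Let na t := `|a t|.
Hypotheses (a_int : mu.-integrable `[0, T] (EFin \o a))
  (na_int : mu.-integrable `[0, T] (EFin \o na))
  (b_int : mu.-integrable `[0, T] (EFin \o b))
  (cp_int : mu.-integrable `[0, T] (EFin \o cp)).
Hypothesis abc_cont : forall t, 0 < t < T -> ~ range tau t ->
  [/\ {for t, continuous a}, {for t, continuous b} & {for t, continuous c}].

Let ka (i : int) := beta i / alpha i.
Let kap (i : int) := Num.max (ka i) 0.
Let n := (r + r)%N.
Let gam := step tau *%R n alpha.
Let J := step tau +%R n kap.

Let gam_neq0 t : gam t != 0.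
Proof.
rewrite /gam /step; apply: (big_ind (fun z : R => z != 0)) => [|p q p0 q0|i _].
- exact: oner_neq0.
- by rewrite mulf_neq0.
- by case: ifP; rewrite ?oner_neq0.
Qed.

(* The window of length [T] from [t] contains exactly one impulse of each
   residue class modulo [r]. *)
Let J_shift t : 0 <= t <= T ->
  J (t + T) - J t = \sum_(1 <= i < r.+1) Num.max (beta i%:Z / alpha i%:Z) 0.
Proof.
move=> /andP[t0 tT].
have split2 s : J s = \sum_(1 <= i < r.+1) (if tau i%:Z < s then kap i else 0) +
    \sum_(1 <= i < r.+1) (if tau i%:Z + T < s then kap i else 0).
  rewrite /J /step /n (@big_cat_nat _ _ _ r.+1)//=; last by rewrite ltnS leq_addr.
  congr (_ + _); rewrite -[in LHS](add1n r) big_addn.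
  have -> : ((r + r).+1 - r)%N = r.+1 by lia.
  apply: eq_bigr => i _; rewrite PoszD tau_per /kap /ka.
  by rewrite alpha_per beta_per.
have le_r i : (1 <= i < r.+1)%N -> 0 < tau i%:Z < T.
  move=> /andP[i1 ir]; apply/andP; split.
    by rewrite (lt_le_trans tau_first)// leNgt (ltr_tau tau_lt) -leNgt lez_nat.
  by rewrite (le_lt_trans _ tau_last)// leNgt (ltr_tau tau_lt) -leNgt lez_nat.
rewrite !split2.
have -> : \sum_(1 <= i < r.+1) (if tau i%:Z < t + T then kap i else 0) =
    \sum_(1 <= i < r.+1) Num.max (beta i%:Z / alpha i%:Z) 0.
  apply: eq_big_nat => i /le_r/andP[_ iT].
  by rewrite (lt_le_trans iT)// lerDr.
have -> : \sum_(1 <= i < r.+1) (if tau i%:Z + T < t + T then kap i else 0) =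
    \sum_(1 <= i < r.+1) (if tau i%:Z < t then kap i else 0).
  by apply: eq_bigr => i _; rewrite ltrD2r.
have -> : \sum_(1 <= i < r.+1) (if tau i%:Z + T < t then kap i else 0) = 0.
  apply: big1_seq => i /andP[_]; rewrite mem_index_iota => /le_r/andP[i0 _].
  by rewrite ltNge (le_trans tT)// lerDr ltW.
ring.
Qed.

(* At [T] only continuity of the primitives is known. *)
Let prim2_d f t : mu.-integrable `[0, T] (EFin \o f) ->
  (forall s, 0 < s < T -> ~ range tau s -> {for s, continuous f}) ->
  periodic_off T tau f -> 0 < t < T + T -> t != T -> ~ range tau t ->
  is_derive t 1 (prim2 T f) (f t).
Proof.
move=> fi fc fp /andP[t0 tTT] tnT nt.
have [tT|Tt|E] := ltgtP t T; last by rewrite E eqxx in tnT.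
  by apply: is_derive_prim2; rewrite ?t0 ?tT//; apply: fc; rewrite ?t0.
have nt' : ~ range tau (t - T).
  by move=> /(range_tau_shift tau_per); rewrite subrK.
have tT' : 0 < t - T < T by rewrite subr_gt0 Tt ltrBlDr.
have := is_derive_prim2_shift T_gt0 fi.
move=> /(_ t); rewrite Tt tTT => /(_ isT (fc _ tT' nt')).
by rewrite -(fp _ nt') subrK.
Qed.

Let tau_itv2 t : 0 <= t <= T + T -> range tau t ->
  exists2 j : nat, (1 <= j <= n)%N & t = tau j%:Z.
Proof.
move=> /andP[t0 tTT] rt; have [tT|Tt] := leP t T.
  have [|j jr ->] := tau_itv T_gt0 r_gt0 tau_lt tau_per tau_first tau_last _ rt.
    by rewrite t0.
  by exists j => //; rewrite /n; lia.
have rt' : range tau (t - T).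
  by apply/(range_tau_shift tau_per); rewrite subrK.
have [|j jr E] := tau_itv T_gt0 r_gt0 tau_lt tau_per tau_first tau_last _ rt'.
  by rewrite subr_ge0 ltW//= lerBlDr.
exists (j + r)%N; first by rewrite /n; lia.
by rewrite PoszD tau_per -E subrK.
Qed.

Let A := prim2 T a.

(* The integral of the positive part of [c], augmented by the positive parts of
   the impulses: its increase over a period is the last factor of the
   criterion. *)
Let C t := prim2 T cp t + J t.

Variables (rho : R) (x u : R -> R).
Hypothesis xu : floquet_solution T tau alpha beta a b c rho x u.
Hypothesis xu_neq0 : forall t, ~ range tau t -> ~ (x t = 0 /\ u t = 0).

Let sol := xu.1.

(** The left-continuous representative of [x]. *)
Let xm t := lim (x s @[s --> t^'-]).

Let xm_cvg t l : x s @[s --> t^'-] --> l -> xm t = l.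
Proof. by move=> H; apply/cvg_lim => //; exact: Rhausdorff. Qed.

Let xm_off t : ~ range tau t -> xm t = x t.
Proof.
by move=> nt; have [/continuous_cvg_lr[/xm_cvg]] := solution_continuous sol nt.
Qed.

(* The solution normalized so that [y] is continuous and the terms in [a]
   disappear from the equations. *)
Let y t := expR (- A t) * xm t / gam t.
Let w t := expR (A t) * u t / gam t.

Let Ac : continuous A. Proof. exact: prim2_continuous. Qed.
Let Cpc : continuous (prim2 T cp). Proof. exact: prim2_continuous. Qed.

Let expA_cvg (k : R) t (F : set_system R) : Filter F -> F `=>` nbhs t ->
  expR (k * A s) @[s --> F] --> expR (k * A t).
Proof.
move=> FF Ft; apply: (cvg_trans (cvg_app _ Ft)).
apply: (@continuous_comp _ _ _ (fun s => k * A s) expR).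
  by apply: cvgM; [exact: cvg_cst|exact: Ac].
exact: continuous_expR.
Qed.

Let left_nbhs (t : R) : t^'- `=>` nbhs t. Proof. exact: cvg_within. Qed.
Let right_nbhs (t : R) : t^'+ `=>` nbhs t. Proof. exact: cvg_within. Qed.

Let scaled_cvg (k : R) (f : R -> R) t (F : set_system R) (l m : R) : Filter F ->
  F `=>` nbhs t -> f s @[s --> F] --> l -> (\forall s \near F, gam s = m) ->
  m != 0 -> expR (k * A s) * f s / gam s @[s --> F] --> expR (k * A t) * l / m.
Proof.
move=> FF Ft fl gm m0; apply: cvgM.
  by apply: cvgM => //; exact: expA_cvg.
apply: cvgV => //; exact: cvg_near_cst.
Qed.

(** Behaviour of the normalized solution at any point of the window. *)
Let local t : 0 <= t <= T + T -> exists wl wr cl cr k : R,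
  [/\ y s @[s --> t^'-] --> y t /\ y s @[s --> t^'+] --> y t,
      w s @[s --> t^'-] --> wl /\ w s @[s --> t^'+] --> wr,
      C s @[s --> t^'-] --> cl, C s @[s --> t^'+] --> cr &
      [/\ wr = wl - k * (expR (2 * A t) * y t), cr = cl + Num.max k 0 & cl = C t]].
Proof.
move=> tTT.
have E1 s : - A s = -1 * A s by rewrite mulN1r.
have E2 s : A s = 1 * A s by rewrite mul1r.
have gl := step_at_left tau *%R n alpha t.
have Jl := step_at_left tau +%R n kap t.
have noff := near_off_tau T_gt0 r_gt0 tau_lt tau_per t.
have ym (F : set_system R) (FF : Filter F) (l : R) : F `=>` nbhs t ->
    (\forall s \near F, s != t) ->
    expR (-1 * A s) * x s / gam s @[s --> F] --> l -> y s @[s --> F] --> l.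
  move=> Ft Fn; apply: cvg_trans; apply: near_eq_cvg.
  have Fo := Ft _ noff.
  by apply: filterS2 Fo Fn => s Hs sn; rewrite /y xm_off ?E1//; exact: Hs.
have Cc (F : set_system R) (FF : Filter F) (m : R) : F `=>` nbhs t ->
    (\forall s \near F, J s = m) -> C s @[s --> F] --> prim2 T cp t + m.
  move=> Ft Jm; apply: cvgD; last exact: cvg_near_cst.
  exact: (cvg_trans (cvg_app (prim2 T cp) Ft) (@Cpc t)).
have [rt|nt] := pselect (range tau t).
  have [j jn tj] := tau_itv2 tTT rt.
  have [xl [ul [xl' ul' xr ur]]] := sol.2 j%:Z.
  rewrite -tj in xl' ul' xr ur.
  have gr := @step_at_right R tau tau_lt _ _ *%R n alpha t j jn tj.
  have Jr := @step_at_right R tau tau_lt _ _ +%R n kap t j jn tj.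
  have al0 := alpha_neq0 j%:Z; have gt0 := gam_neq0 t.
  have ag0 : alpha j%:Z * gam t != 0 by rewrite mulf_neq0.
  have yt : y t = expR (-1 * A t) * xl / gam t by rewrite /y (xm_cvg xl') E1.
  exists (expR (1 * A t) * ul / gam t),
    (expR (1 * A t) * (alpha j * ul - beta j * xl) / (alpha j * gam t)),
    (prim2 T cp t + J t), (prim2 T cp t + (kap j%:Z + J t)), (ka j%:Z).
  split.
  - split; rewrite yt; apply: ym.
    + exact: left_nbhs.
    + exact: nbhs_left_neq.
    + by apply: scaled_cvg => //; exact: left_nbhs.
    + exact: right_nbhs.
    + exact: nbhs_right_neq.
    + have -> : expR (-1 * A t) * xl / gam t =
        expR (-1 * A t) * (alpha j * xl) / (alpha j * gam t).
        by field; rewrite al0 gt0.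
      by apply: scaled_cvg => //; exact: right_nbhs.
  - have -> : w = fun s => expR (1 * A s) * u s / gam s.
      by apply/funext => s; rewrite /w -E2.
    split; first by apply: scaled_cvg => //; exact: left_nbhs.
    by apply: scaled_cvg => //; exact: right_nbhs.
  - by apply: Cc => //; exact: left_nbhs.
  - by apply: Cc => //; exact: right_nbhs.
  - split=> //; last by rewrite /kap addrCA addrC.
    have -> : expR (2 * A t) * y t = expR (1 * A t) * xl / gam t.
      by rewrite yt !mulrA -expRD; congr (expR _ * _ / _); ring.
    by rewrite /ka; field; rewrite al0 gt0.
have gn := @step_near R tau _ _ *%R n alpha t nt.
have Jn := @step_near R tau _ _ +%R n kap t nt.
have [/continuous_cvg_lr[xl xr] /continuous_cvg_lr[ul ur]] :=
  solution_continuous sol nt.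
have yt : y t = expR (-1 * A t) * x t / gam t by rewrite /y xm_off ?E1.
exists (w t), (w t), (C t), (C t), 0; split.
- split; rewrite yt; apply: ym.
  + exact: left_nbhs.
  + exact: nbhs_left_neq.
  + by apply: scaled_cvg => //; exact: left_nbhs.
  + exact: right_nbhs.
  + exact: nbhs_right_neq.
  + by apply: scaled_cvg => //; exact: right_nbhs.
- have -> : w t = expR (1 * A t) * u t / gam t by rewrite /w -E2.
  have -> : w = fun s => expR (1 * A s) * u s / gam s.
    by apply/funext => s; rewrite /w -E2.
  split; first by apply: scaled_cvg => //; exact: left_nbhs.
  by apply: scaled_cvg => //; exact: right_nbhs.
- by apply: Cc => //; exact: left_nbhs.
- by apply: Cc => //; exact: right_nbhs.
- by rewrite mul0r subr0 maxxx addr0.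
Qed.

Let step_cst (K : Type) (idx : K) (op : Monoid.com_law idx) (k : int -> K) t :
  ~ range tau t -> \forall s \near t, step tau op n k t = step tau op n k s.
Proof.
by move=> nt; have := @step_near R tau K idx op n k t nt; apply: filterS => s ->.
Qed.

Let yd t : ~ range tau t -> is_derive t 1 A (a t) ->
  is_derive t 1 y (expR (- (2 * A t)) * (b t * w t)).
Proof.
move=> nt dA; have [dx du] := sol.1 t nt.
have d1 := is_derive_scale (gam t)^-1
  (is_derive_mul (is_derive_expR_comp (is_derive_opp dA)) dx).
have E : \forall s \near t, (gam t)^-1 * (expR (- A s) * x s) = y s.
  have gn := @step_cst _ _ *%R alpha t nt.
  have noff := near_off_range T_gt0 r_gt0 tau_lt tau_per nt.
  by apply: filterS2 gn noff => s gs ns; rewrite /y xm_off// /gam gs mulrC.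
apply: is_derive_eq (near_eq_is_derive E d1) _.
have -> : expR (- (2 * A t)) * (b t * w t) =
    expR (- (2 * A t)) * expR (A t) * (b t * (u t / gam t)).
  by rewrite /w; ring.
rewrite -expRD; have -> : - (2 * A t) + A t = - A t by ring.
by field; exact: gam_neq0.
Qed.

Let wd t : ~ range tau t -> is_derive t 1 A (a t) ->
  is_derive t 1 w (- (expR (2 * A t) * (c t * y t))).
Proof.
move=> nt dA; have [dx du] := sol.1 t nt.
have d1 := is_derive_scale (gam t)^-1
  (is_derive_mul (is_derive_expR_comp dA) du).
have E : \forall s \near t, (gam t)^-1 * (expR (A s) * u s) = w s.
  have := @step_cst _ _ *%R alpha t nt.
  by apply: filterS => s gs; rewrite /w /gam gs mulrC.
apply: is_derive_eq (near_eq_is_derive E d1) _.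
have -> : expR (2 * A t) * (c t * y t) =
    expR (2 * A t) * expR (- A t) * (c t * (x t / gam t)).
  by rewrite /y xm_off//; ring.
rewrite -expRD; have -> : 2 * A t + - A t = A t by ring.
by field; exact: gam_neq0.
Qed.

(** If the first component of a Floquet solution vanishes at [t0], it also
vanishes at [t0 + T], and Lyapunov's inequality holds with the data of one
period. *)
Lemma zero_lyapunov t0 : 0 <= t0 <= T -> x s @[s --> t0^'-] --> 0 ->
  4 <= expR (2 * \int[mu]_(t in `[0, T]) `|a t|)
       * (\int[mu]_(t in `[0, T]) b t)
       * (\int[mu]_(t in `[0, T]) Num.max (c t) 0
          + \sum_(1 <= i < r.+1) Num.max (beta i%:Z / alpha i%:Z) 0).
Proof.
move=> t0T x0; have /andP[t00 t0T'] := t0T.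
have [D HD] := tau_locally_finite T_gt0 r_gt0 tau_lt tau_per 0 (T + T).
have win t : t0 <= t <= t0 + T -> 0 <= t <= T + T.
  move=> /andP[tt tT]; rewrite (le_trans t00 tt) (le_trans tT)//.
  by rewrite lerD2r.
have win' t : t0 < t < t0 + T -> 0 < t < T + T.
  move=> /andP[tt tT]; rewrite (le_lt_trans t00 tt) (lt_le_trans tT)//.
  by rewrite lerD2r.
have offD t : t0 < t < t0 + T -> t \notin T :: D -> t != T /\ ~ range tau t.
  rewrite inE negb_or => tt /andP[-> tD]; split=> // rt.
  have := HD t; rewrite (negbTE tD) => H; have // : false; apply: H => //.
  by apply: win; case/andP: tt => *; rewrite !ltW.
have na_c t : 0 < t < T -> ~ range tau t -> {for t, continuous na}.
  by move=> tT nt; have [ac _ _] := abc_cont tT nt; exact: cvg_norm.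
have cp_c t : 0 < t < T -> ~ range tau t -> {for t, continuous cp}.
  move=> tT nt; have [_ _ cc] := abc_cont tT nt.
  by apply: (@continuous_max R R c (fun=> 0)) => //; exact: cvg_cst.
have na_per : periodic_off T tau na by move=> t nt; rewrite /na a_per.
have cp_per : periodic_off T tau cp by move=> t nt; rewrite /cp c_per.
have dA t : t0 < t < t0 + T -> t \notin T :: D -> is_derive t 1 A (a t).
  move=> tt /(offD _ tt)[tT nt]; apply: prim2_d => //; last exact: win'.
  by move=> s sT ns; have [] := abc_cont sT ns.
have dAb t : t0 < t < t0 + T -> t \notin T :: D ->
    is_derive t 1 (prim2 T na) (na t).
  by move=> tt /(offD _ tt)[tT nt]; apply: prim2_d => //; exact: win'.
have dP t : t0 < t < t0 + T -> t \notin T :: D ->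
    is_derive t 1 (prim2 T b) (b t).
  move=> tt /(offD _ tt)[tT nt]; apply: prim2_d => //; last exact: win'.
  by move=> s sT ns; have [] := abc_cont sT ns.
have dC t : t0 < t < t0 + T -> t \notin T :: D -> is_derive t 1 C (cp t).
  move=> tt /(offD _ tt)[tT nt].
  have dJ : is_derive t 1 J 0.
    exact: near_eq_is_derive (@step_cst _ _ +%R kap t nt) (is_derive_cst (J t) t 1).
  have d1 : is_derive t 1 (prim2 T cp) (cp t).
    by apply: prim2_d => //; exact: win'.
  by apply: is_derive_eq (is_derive_add d1 dJ) _; rewrite addr0.
have red : reduced_solution A b c C (T :: D) t0 (t0 + T) y w.
  split.
  - move=> t /win tt; have [wl [wr [cl [cr [k [yc _ _ _ _]]]]]] := local tt.
    exact/left_right_continuousP.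
  - by move=> t tt tD; apply: yd; [exact: (offD t tt tD).2|exact: dA].
  - by move=> t tt tD; apply: wd; [exact: (offD t tt tD).2|exact: dA].
  - move=> t /win'/andP[/ltW tt /ltW tt'] _.
    have [|wl [wr [cl [cr [k [_ [wl' wr'] cl' cr' [Ew Ec _]]]]]]] := @local t.
      by rewrite tt.
    by exists wl, wr, cl, cr, k.
have sT : t0 < t0 + T by rewrite ltrDl.
have sin : t0 <= t0 <= t0 + T by rewrite lexx ltW.
have ein : t0 <= t0 + T <= t0 + T by rewrite lexx andbT ltW.
have [wl0 [wr0 [cl0 [cr0 [k0 [_ _ _ cr0' [_ Ecr0 Ecl0]]]]]]] := local (win _ sin).
have [wl1 [wr1 [cl1 [cr1 [k1 [_ _ cl1' _ [_ _ Ecl1]]]]]]] := local (win _ ein).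
have ys : y t0 = 0 by rewrite /y (xm_cvg x0) mulr0 mul0r.
have ye : y (t0 + T) = 0.
  have [xl [ul [al [be [_ xl' _ _ _]]]]] := solution_lims alpha_neq0 (t0 + T) sol.
  have H1 := cvg_left_shift xl'.
  have H2 : x (s + T) @[s --> t0^'-] --> rho * 0.
    apply: (@cvg_trans _ ((fun s => rho * x s) @ t0^'-)).
      apply: near_eq_cvg.
      have noff := left_nbhs (near_off_tau T_gt0 r_gt0 tau_lt tau_per t0).
      apply: filterS2 noff (nbhs_left_neq t0) => s Hs /Hs ns.
      by have [] := xu.2 s ns.
    by apply: cvgM => //; exact: cvg_cst.
  have E := cvg_unique (@Rhausdorff R) H1 H2.
  by rewrite /y (xm_cvg xl') E !mulr0 mul0r.
(* If [x] vanished identically on the window, then so would [b u], hence [u]. *)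
have [m mse ym] : exists2 m, t0 <= m <= t0 + T & y m != 0.
  apply: contrapT => noy.
  have x_0 s : t0 < s < t0 + T -> ~ range tau s -> x s = 0.
    move=> ss ns; apply: contrapT => xs; apply: noy; exists s.
      by case/andP: ss => *; rewrite !ltW.
    rewrite /y xm_off//; apply: mulf_neq0; last exact: invr_neq0.
    by apply: mulf_neq0; [rewrite gt_eqF ?expR_gt0|exact/eqP].
  have [t tt tD] := exists_off_seq (T :: D) sT.
  have [tT nt] := offD t tt tD.
  have [dx _] := sol.1 t nt.
  have : is_derive t 1 x 0.
    apply: near_eq_is_derive (is_derive_cst 0 t 1).
    have noff := near_off_range T_gt0 r_gt0 tau_lt tau_per nt.
    case/andP: tt => tt1 tt2.
    by near=> s; rewrite x_0//; [apply/andP; split; near: s;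
      [exact: lt_nbhsr|exact: lt_nbhsl]|exact: (near noff)].
  case: dx => _ dx [_]; rewrite dx (x_0 t tt nt) mulr0 add0r => /eqP.
  rewrite mulf_eq0 gt_eqF ?b_gt0//= => /eqP ut.
  exact: xu_neq0 nt (conj (x_0 t tt nt) ut).
have nac : continuous (prim2 T na) by exact: prim2_continuous.
have Pc : continuous (prim2 T b) by exact: prim2_continuous.
have prims t : t0 < t < t0 + T -> t \notin T :: D ->
    [/\ is_derive t 1 A (a t), is_derive t 1 (prim2 T na) `|a t|,
      is_derive t 1 (prim2 T b) (b t), is_derive t 1 C (Num.max (c t) 0) &
      0 <= b t].
  move=> tt tD; split; [exact: dA|exact: dAb|exact: dP|exact: dC|].
  by apply/ltW/b_gt0; exact: (offD t tt tD).2.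
have L4 := @lyapunov R a b c A (prim2 T na) (prim2 T b) C (T :: D) t0 (t0 + T)
  cr0 cl1 sT Ac nac Pc prims cr0' cl1' y w m red ys ye mse ym.
have P0 : 0 <= prim2 T b (t0 + T) - prim2 T b t0.
  rewrite subr_ge0; apply: (le_derive_ge0 (ltW sT) _ dP).
  - by move=> t _; exact: Pc.
  - by move=> t tt /(offD t tt)[_ nt]; apply/ltW/b_gt0.
rewrite !prim2_shift// in L4 P0.
apply: le_trans L4 _; apply: ler_wpM2l; first by rewrite mulr_ge0// expR_ge0.
rewrite Ecr0 Ecl0 Ecl1 -(J_shift t0T) -(@prim2_shift R T T_gt0 cp t0)// /C.
have : 0 <= Num.max k0 0 by rewrite le_max lexx orbT.
lra.
Unshelve. all: by end_near. Qed.

End lyapunov_obstruction.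

(** * The stability criterion *)

Section coefficient_bound.
Variables (R : realType) (T : R) (r : nat) (tau : int -> R).
Hypotheses (T_gt0 : 0 < T) (r_gt0 : (0 < r)%N).
Hypothesis tau_lt : forall i : int, tau i < tau (i + 1).
Hypothesis tau_per : forall i : int, tau (i + r%:Z) = tau i + T.
Hypotheses (tau_first : 0 < tau 1) (tau_last : tau r%:Z < T).

Lemma periodic_PC_bounded (f : R -> R) :
  periodic_off T tau f -> in_PC T r tau f ->
  exists M : R, forall t, ~ range tau t -> `|f t| <= M.
Proof.
move=> fp fPC.
have [M HM] := in_PC_bounded T_gt0 r_gt0 tau_lt tau_per tau_first tau_last fPC.
exists M => t nt.
have [s [sT _] fs] := periodic_off_base T_gt0 tau_per nt.
by rewrite fs// HM.
Qed.

End coefficient_bound.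

Theorem theorem3p1 (R : realType) (T : R) (r : nat)
    (tau alpha beta : int -> R) (a b c : R -> R)
    (T_gt0 : 0 < T) (r_gt0 : (0 < r)%N)
    (tau_lt : forall i : int, tau i < tau (i + 1))
    (tau_per : forall i : int, tau (i + r%:Z) = tau i + T)
    (tau_first : 0 < tau 1) (tau_last : tau r%:Z < T)
    (a_per : periodic_off T tau a)
    (b_per : periodic_off T tau b)
    (c_per : periodic_off T tau c)
    (a_PC : in_PC T r tau a) (b_PC : in_PC T r tau b) (c_PC : in_PC T r tau c)
    (alpha_neq0 : forall i : int, alpha i != 0)
    (alpha_per : forall i : int, alpha (i + r%:Z) = alpha i)
    (beta_per : forall i : int, beta (i + r%:Z) = beta i)
    (prod_alpha : \prod_(1 <= i < r.+1) alpha i%:Z ^+ 2 = 1)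
    (b_gt0 : forall t, ~ range tau t -> 0 < b t)
    (mean_gt0 :
      (0 < \int[lebesgue_measure]_(t in `[0%R, T]) (c t - a t ^+ 2 / b t)%:E
           + (\sum_(1 <= i < r.+1) beta i%:Z / alpha i%:Z)%:E)%E)
    (lyapunov_lt4 :
      expR (2 * \int[lebesgue_measure]_(t in `[0, T]) `|a t|)
      * (\int[lebesgue_measure]_(t in `[0, T]) b t)
      * (\int[lebesgue_measure]_(t in `[0, T]) Num.max (c t) 0
         + \sum_(1 <= i < r.+1) Num.max (beta i%:Z / alpha i%:Z) 0) < 4) :
  stable tau alpha beta a b c.
Proof.
have [Ma aM] := periodic_PC_bounded T_gt0 r_gt0 tau_lt tau_per tau_first
  tau_last a_per a_PC.
have [Mb bM] := periodic_PC_bounded T_gt0 r_gt0 tau_lt tau_per tau_first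
  tau_last b_per b_PC.
have [Mc cM] := periodic_PC_bounded T_gt0 r_gt0 tau_lt tau_per tau_first
  tau_last c_per c_PC.
pose K := Num.max Ma (Num.max Mb Mc).
have abc_le t : ~ range tau t -> [/\ `|a t| <= K, `|b t| <= K & `|c t| <= K].
  by move=> nt; rewrite /K !le_max aM// bM// cM// !orbT.
have contPC f t := @in_PC_continuous R T r tau T_gt0 r_gt0 tau_lt tau_per f t.
have bndPC f := @in_PC_bounded R T r tau T_gt0 r_gt0 tau_lt tau_per tau_first
  tau_last f.
have intPC := @integrable_off_tau R T r tau T_gt0 r_gt0 tau_lt tau_per.
have ac t := contPC a t a_PC; have bc t := contPC b t b_PC.
have cc t := contPC c t c_PC.
have [Na aN] := bndPC a a_PC; have [Nb bN] := bndPC b b_PC.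
have [Nc cN] := bndPC c c_PC.
have a_int := intPC a Na ac aN; have b_int := intPC b Nb bc bN.
have na_int : lebesgue_measure.-integrable `[0, T] (EFin \o (fun t => `|a t|)).
  apply: (intPC _ Na) => [t tT nt|t tT]; last by rewrite normr_id aN.
  exact: cvg_norm (ac t tT nt).
have cp_int :
    lebesgue_measure.-integrable `[0, T] (EFin \o (fun t => Num.max (c t) 0)).
  apply: (intPC _ Nc) => [t tT nt|t tT].
    by apply: (@continuous_max R R c (fun=> 0)); [exact: cc|exact: cvg_cst].
  rewrite ger0_norm ?le_max ?lexx ?orbT// ge_max.
  by rewrite (le_trans (ler_norm _) (cN t tT)) (le_trans _ (cN t tT)).
pose g t := c t - a t ^+ 2 / b t.
have g_cont t : 0 < t < T -> ~ range tau t -> {for t, continuous g}.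
  move=> tT nt; apply: cvgB; first exact: cc.
  apply: cvgM; first by apply: cvgM; exact: ac.
  by apply: cvgV; [rewrite gt_eqF ?b_gt0|exact: bc].
have g_le t : 0 <= t <= T -> ~ range tau t -> g t <= Nc.
  move=> tT nt; rewrite /g lerBlDr (le_trans (ler_norm _))// (le_trans (cN t tT))//.
  by rewrite lerDl divr_ge0 ?sqr_ge0// ltW// b_gt0.
have g_int := integrable_of_upper_bound T_gt0 r_gt0 tau_lt tau_per
  g_cont g_le mean_gt0.
move=> x u /hamiltonian_solutionW xu.
have [//|[rho [y [v [rho0 yv yv0]]]]] := bounded_or_floquet T_gt0 r_gt0 tau_lt
  tau_per tau_first tau_last a_per b_per c_per alpha_neq0 alpha_per beta_per
  prod_alpha abc_le xu.
exfalso.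
have [[t0 t0T y0]|no_zero] := pselect (exists2 t0, 0 <= t0 <= T &
    y s @[s --> t0^'-] --> 0).
  move: lyapunov_lt4; apply/negP; rewrite -leNgt.
  apply: (zero_lyapunov T_gt0 r_gt0 tau_lt tau_per tau_first tau_last
    a_per b_per c_per alpha_neq0 alpha_per beta_per b_gt0 a_int na_int b_int
    cp_int _ yv yv0 t0T y0) => t tT nt.
  by split; [exact: ac|exact: bc|exact: cc].
have := riccati_le0 T_gt0 r_gt0 tau_lt tau_per tau_first tau_last alpha_neq0
  b_gt0 g_int g_cont yv rho0.
have H t l : 0 <= t <= T -> y s @[s --> t^'-] --> l -> l != 0.
  move=> tT yl; apply/eqP => l0; apply: no_zero.
  by exists t; rewrite // -[X in _ --> X]l0.
move=> /(_ H); apply/negP; rewrite -ltNge -lte_fin EFinD.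
rewrite /Rintegral fineK//; exact: integrable_fin_num.
Qed.
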